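(* Let $A$ be a Banach Q-algebra with an identity ${\bf e}$ of norm $1$, and let $E$ be a Banach Q-space. Equip $A\widehat\otimes_{op}E$ with the left Banach Q-module structure over $A$ determined by $a\cdot(b\otimes y)=(ab)\otimes y$. Then $A\widehat\otimes_{op}E$ is a free object with the base $E$ in the rigged category $(\mathbf{QA\mbox{-}mod},\square)$. Namely, for every left Banach Q-module $Y$ over $A$ (in $\mathbf{QA\mbox{-}mod}$) there is a bijection $$\mathcal{I}_{E,Y}:\mathbf{h}_{\mathbf{QBan}}(E,\square Y)\to\mathbf{h}_{\mathbf{QA\mbox{-}mod}}(A\widehat\otimes_{op}E,Y),$$ natural in $Y$; this bijection takes a completely bounded operator $\varphi:E\to Y$ to the morphism $S:A\widehat\otimes_{op}E\to Y$ well defined by $a\otimes x\mapsto a\cdot\varphi(x)$.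
   Context: Notation. $L$ is a fixed separable infinite-dimensional Hilbert space, $\mathcal{B}=\mathcal{B}(L)$ is the algebra of bounded operators on $L$, and $\mathcal{F}\subset\mathcal{B}$ is the (non-closed) two-sided ideal of bounded finite rank operators with the operator norm. For a complex linear space $E$ its amplification is the algebraic tensor product $\mathcal{F}E:=\mathcal{F}\otimes E$; elementary tensors are written $ax$ ($a\in\mathcal{F}$, $x\in E$). $\mathcal{F}E$ is a $\mathcal{B}$-bimodule via $a\cdot(bx)=(ab)x$, $(bx)\cdot a=(ba)x$. An orthogonal projection $P\in\mathcal{B}$ is a support of $u\in\mathcal{F}E$ if $P\cdot u=u=u\cdot P$. Q-spaces. A Q-norm on $E$ is a norm on $\mathcal{F}E$ such that (i) $\|a\cdot u\cdot b\|\le\|a\|\|u\|\|b\|$ for $a,b\in\mathcal{B}$, $u\in\mathcal{F}E$; (ii) $\|u+v\|=\max\{\|u\|,\|v\|\}$ whenever $u,v\in\mathcal{F}E$ have supports that are mutually orthogonal. A Q-space is a linear space with a Q-norm. Its underlying norm is $\|x\|:=\|px\|$, where $p$ is any rank one orthogonal projection (the result does not depend on $p$). A Q-space is complete (Banach) if its underlying normed space is complete. Every Q-space has a completion: a complete Q-space $\overline{E}$ with an operator $i:E\to\overline{E}$ such that $\mathbf{1}_{\mathcal{F}}\otimes i$ is isometric and $i$ is the completion of the underlying normed space. Completely bounded maps. For a linear operator $\varphi:E\to F$ between Q-spaces put $\varphi_\infty:=\mathbf{1}_{\mathcal{F}}\otimes\varphi:\mathcal{F}E\to\mathcal{F}F$,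 $ax\mapsto a\varphi(x)$; $\varphi$ is completely bounded if $\varphi_\infty$ is bounded, and $\|\varphi\|_{cb}:=\|\varphi_\infty\|$. Fix a unitary isomorphism $\iota$ from the Hilbert tensor square of $L$ onto $L$, and for $a,b\in\mathcal{B}$ put $a\diamondsuit b:=\iota(a\otimes b)\iota^{-1}\in\mathcal{B}$ (where $a\otimes b$ is the Hilbert tensor product of operators). For a bilinear operator $\mathcal{R}:E\times F\to G$ its amplification $\mathcal{R}_\infty:\mathcal{F}E\times\mathcal{F}F\to\mathcal{F}G$ is the bilinear operator well defined by $\mathcal{R}_\infty(ax,by)=(a\diamondsuit b)\mathcal{R}(x,y)$. $\mathcal{R}$ is completely contractive if $\mathcal{R}_\infty$ is contractive. Q-algebras and Q-modules. A Q-algebra is a complex associative algebra that is also a Q-space and whose multiplication is a completely contractive bilinear operator. A left Q-module over a Q-algebra $A$ is a left $A$-module that is also a Q-space and whose outer multiplication is a completely contractive bilinear operator. They are called Banach if the Q-space is complete. A morphism of Q-modules is a completely bounded $A$-module map. Here all modules over the unital algebra $A$ are assumed to satisfy ${\bf e}\cdot x=x$. Operator-projective tensor product. For $u\in\mathcal{F}E$, $v\in\mathcal{F}F$ let $u\diamondsuit v\in\mathcal{F}(E\otimes F)$ be defined bilinearly by $ax\diamondsuit by:=(a\diamondsuit b)(x\otimes y)$. Every $U\in\mathcal{F}(E\otimes F)$ can be written as $a\cdot(u\diamondsuit v)\cdot b$ with $a,b\in\mathcal{F}$, $u\in\mathcal{F}E$, $v\in\mathcal{F}F$, and $\|U\|_{op}:=\inf\|a\|\|u\|\|v\|\|b\|$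 over all such representations is a Q-norm on $E\otimes F$. The resulting Q-space is $E\otimes_{op}F$ and its completion is the Banach Q-space $E\widehat\otimes_{op}F$. Categories. $\mathbf{QBan}$ is the category of Banach Q-spaces and completely bounded operators; $\mathbf{QA\mbox{-}mod}$ is the category of left Banach Q-modules over $A$ and their (completely bounded) morphisms; $\square:\mathbf{QA\mbox{-}mod}\to\mathbf{QBan}$ is the functor forgetting the outer multiplication. $\mathbf{h}_{\mathcal{C}}(\cdot,\cdot)$ denotes the set of morphisms in a category $\mathcal{C}$. A rigged category is a category $\mathcal{K}$ with a faithful covariant functor $\square:\mathcal{K}\to\mathcal{L}$; an object $\mathbf{Fr}(M)$ of $\mathcal{K}$ is free with the base $M\in\mathcal{L}$ if for every $X\in\mathcal{K}$ there is a bijection $\mathbf{h}_{\mathcal{L}}(M,\square X)\to\mathbf{h}_{\mathcal{K}}(\mathbf{Fr}(M),X)$ natural in $X$. *)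

(* Defs.v *)
From HB Require Import structures.
From mathcomp Require Import all_boot all_order all_algebra.
From mathcomp Require Import all_classical all_reals all_analysis.
From mathcomp Require Import complex.

Set Implicit Arguments.
Unset Strict Implicit.
Unset Printing Implicit Defensive.

Import Order.TTheory GRing.Theory Num.Theory.
Import numFieldNormedType.Exports.

Local Open Scope classical_set_scope.
Local Open Scope ring_scope.
Local Open Scope quotient_scope.

Definition is_bilinear (K : nzRingType) (V W Z : lmodType K)
    (b : V -> W -> Z) : Prop :=
  (forall w, linear (b^~ w)) /\ (forall v, linear (b v)).

Section Tensor.
Variable K : comNzRingType.

Section TensorDef.
Variables V W : lmodType K.
Implicit Types s t : seq (V * W).

(* A sequence [:: (v1, w1); ...; (vn, wn)] stands for the formal sum
   v1 (x) w1 + ... + vn (x) wn. Two formal sums are identified when no bilinear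
   map tells them apart; the quotient then has the universal property of the
   tensor product (lemmas [pure_bilinear], [tens_sum] and [tliftE]). *)
Definition tens_eq s t : bool :=
  `[< forall (Z : lmodType K) (b : V -> W -> Z), is_bilinear b ->
      \sum_(p <- s) b p.1 p.2 = \sum_(p <- t) b p.1 p.2 >].

Lemma tens_eq_refl : reflexive tens_eq.
Proof. by move=> s; apply/asboolP. Qed.

Lemma tens_eq_sym : symmetric tens_eq.
Proof.
by move=> s t; apply/asboolP/asboolP => h Z b hb; rewrite h.
Qed.

Lemma tens_eq_trans : transitive tens_eq.
Proof.
by move=> t s u /asboolP h1 /asboolP h2; apply/asboolP => Z b hb; rewrite h1 ?h2.
Qed.

Canonical tens_equiv := EquivRel tens_eq tens_eq_refl tens_eq_sym tens_eq_trans.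

Definition tens : Type := {eq_quot tens_equiv}.
HB.instance Definition _ := Choice.on tens.
HB.instance Definition _ : Quotient (seq (V * W)) tens := Quotient.on tens.

Definition tens_zero : tens := \pi_tens [::].
Definition tens_add (x y : tens) : tens := \pi_tens (repr x ++ repr y).
Definition tens_scale (k : K) (x : tens) : tens :=
  \pi_tens [seq (k *: p.1, p.2) | p <- repr x].
Definition tens_opp (x : tens) : tens := tens_scale (-1) x.

Definition tlift (Z : lmodType K) (b : V -> W -> Z) (x : tens) : Z :=
  \sum_(p <- repr x) b p.1 p.2.

Lemma tlift_pi (Z : lmodType K) (b : V -> W -> Z) s : is_bilinear b ->
  tlift b (\pi_tens s) = \sum_(p <- s) b p.1 p.2.
Proof.
move=> hb; rewrite /tlift.
have /eqmodP/asboolP : repr (\pi_tens s) = s %[mod tens] by rewrite reprK.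
exact.
Qed.

Lemma tlift_inj (x y : tens) :
  (forall (Z : lmodType K) (b : V -> W -> Z), is_bilinear b ->
     tlift b x = tlift b y) -> x = y.
Proof.
move=> h; rewrite -[x]reprK -[y]reprK; apply/eqmodP/asboolP => Z b hb.
exact: h.
Qed.

Lemma tlift0 (Z : lmodType K) (b : V -> W -> Z) : is_bilinear b ->
  tlift b tens_zero = 0.
Proof. by move=> hb; rewrite tlift_pi// big_nil. Qed.

Lemma tliftD (Z : lmodType K) (b : V -> W -> Z) x y : is_bilinear b ->
  tlift b (tens_add x y) = tlift b x + tlift b y.
Proof. by move=> hb; rewrite tlift_pi// big_cat. Qed.

Lemma tliftZ (Z : lmodType K) (b : V -> W -> Z) k x : is_bilinear b ->
  tlift b (tens_scale k x) = k *: tlift b x.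
Proof.
move=> hb; rewrite tlift_pi// big_map scaler_sumr; apply: eq_bigr => p _ /=.
exact: (scalable_linear (hb.1 p.2)).
Qed.

Lemma tens_addA : associative tens_add.
Proof. by move=> x y z; apply: tlift_inj => Z b hb; rewrite !tliftD// addrA. Qed.

Lemma tens_addC : commutative tens_add.
Proof. by move=> x y; apply: tlift_inj => Z b hb; rewrite !tliftD// addrC. Qed.

Lemma tens_add0 : left_id tens_zero tens_add.
Proof. by move=> x; apply: tlift_inj => Z b hb; rewrite tliftD// tlift0// add0r. Qed.

Lemma tens_addN : left_inverse tens_zero tens_opp tens_add.
Proof.
move=> x; apply: tlift_inj => Z b hb.
by rewrite tliftD// tlift0// tliftZ// scaleN1r addNr.
Qed.

HB.instance Definition _ :=
  GRing.isZmodule.Build tens tens_addA tens_addC tens_add0 tens_addN.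

Lemma tens_scaleA k l x : tens_scale k (tens_scale l x) = tens_scale (k * l) x.
Proof. by apply: tlift_inj => Z b hb; rewrite !tliftZ// scalerA. Qed.

Lemma tens_scale1 : left_id 1 tens_scale.
Proof. by move=> x; apply: tlift_inj => Z b hb; rewrite !tliftZ// scale1r. Qed.

Lemma tens_scaleDr : right_distributive tens_scale +%R.
Proof.
move=> k x y; apply: tlift_inj => Z b hb.
by rewrite tliftZ// !tliftD// !tliftZ// scalerDr.
Qed.

Lemma tens_scaleDl x : {morph tens_scale^~ x : k l / k + l}.
Proof.
move=> k l; apply: tlift_inj => Z b hb.
by rewrite tliftD// !tliftZ// scalerDl.
Qed.

HB.instance Definition _ := GRing.Zmodule_isLmodule.Build K tens
  tens_scaleA tens_scale1 tens_scaleDr tens_scaleDl.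

Definition pure (v : V) (w : W) : tens := \pi_tens [:: (v, w)].

Lemma tliftE (Z : lmodType K) (b : V -> W -> Z) v w : is_bilinear b ->
  tlift b (pure v w) = b v w.
Proof. by move=> hb; rewrite tlift_pi// big_seq1. Qed.

Lemma tlift_linear (Z : lmodType K) (b : V -> W -> Z) :
  is_bilinear b -> linear (tlift b).
Proof. by move=> hb k x y; rewrite tliftD// tliftZ. Qed.

Lemma pure_bilinear : is_bilinear pure.
Proof.
by split=> [w k x y|v k x y]; apply: tlift_inj => Z b hb;
  rewrite tlift_linear// !tliftE//; [exact: hb.1 | exact: hb.2].
Qed.

Lemma tens_sum (x : tens) : x = \sum_(p <- repr x) pure p.1 p.2.
Proof.
apply: tlift_inj => Z b hb.
have lin := tlift_linear hb.
pose f := GRing.isLinear.Build _ _ _ _ (tlift b) lin.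
pose F : {linear tens -> Z} := HB.pack (tlift b) f.
rewrite -[RHS]/(F _) raddf_sum /= {1}/tlift.
by apply: eq_bigr => p _; rewrite tliftE.
Qed.

Lemma tens_ext (Z : lmodType K) (f g : tens -> Z) : linear f -> linear g ->
  (forall v w, f (pure v w) = g (pure v w)) -> f = g.
Proof.
move=> lf lg fg; apply/funext => x.
pose f' := GRing.isLinear.Build _ _ _ _ f lf.
pose F : {linear tens -> Z} := HB.pack f f'.
pose g' := GRing.isLinear.Build _ _ _ _ g lg.
pose G : {linear tens -> Z} := HB.pack g g'.
rewrite (tens_sum x) -[LHS]/(F _) -[RHS]/(G _) !raddf_sum.
by apply: eq_bigr => p _; exact: fg.
Qed.

End TensorDef.

Definition tens_map (V W V' W' : lmodType K) (f : V -> V') (g : W -> W') :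
  tens V W -> tens V' W' := tlift (fun v w => pure (f v) (g w)).

Section TensorMap.
Variables (V W V' W' : lmodType K) (f : V -> V') (g : W -> W').
Hypotheses (lf : linear f) (lg : linear g).

Lemma tens_map_bilinear : is_bilinear (fun v w => pure (f v) (g w)).
Proof.
have [hl hr] := pure_bilinear V' W'.
by split=> [w k x y|v k x y] /=; [rewrite lf; exact: hl | rewrite lg; exact: hr].
Qed.

Lemma tens_mapE v w : tens_map f g (pure v w) = pure (f v) (g w).
Proof. exact/tliftE/tens_map_bilinear. Qed.

Lemma tens_map_linear : linear (tens_map f g).
Proof. exact/tlift_linear/tens_map_bilinear. Qed.

End TensorMap.
End Tensor.

Notation "x '⊗' y" := (pure x y) (at level 40, left associativity).

Definition rnorm (R : realType) (V : normedZmodType R[i]) (x : V) : R :=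
  complex.Re `|x|.

Record hilbert (R : realType) := Hilbert {
  hcarrier :> completeNormedModType R[i];
  hdot : {dot hcarrier for @Num.conj R[i]};
  hdot_norm : forall x : hcarrier, `|x| ^+ 2 = hdot x x }.

Definition separable (T : topologicalType) : Prop :=
  exists2 S : set T, countable S & dense S.

Definition in_span (K : nzRingType) (V : lmodType K) (s : seq V) (v : V) : Prop :=
  exists c : nat -> K, v = \sum_(j < size s) c j *: s`_j.

Definition infinite_dimensional (K : nzRingType) (V : lmodType K) : Prop :=
  forall s : seq V, exists v, ~ in_span s v.

Section Operators.
Variables (R : realType) (H : hilbert R).

Definition bounded_op : {pred (H -> H)} := fun f =>
  `[< linear f /\ exists M : R[i], forall x, `|f x| <= M * `|x| >].

Lemma bounded_op_submod : submod_closed bounded_op.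
Proof.
split.
  apply/asboolP; split; first by move=> k x y /=; rewrite scaler0 addr0.
  by exists 0 => x; rewrite normr0 mul0r.
move=> k f g /asboolP[lf [M hM]] /asboolP[lg [N hN]]; apply/asboolP.
have E x : (k *: f + g) x = k *: f x + g x by [].
split.
  move=> c x y; rewrite !E lf lg !scalerDr !scalerA mulrC.
  by rewrite addrACA.
exists (`|k| * M + N) => x; rewrite E (le_trans (ler_normD _ _))//.
by rewrite mulrDl lerD// normrZ -mulrA ler_wpM2l.
Qed.

HB.instance Definition _ :=
  GRing.isSubmodClosed.Build R[i] (H -> H) bounded_op bounded_op_submod.

Record bop := Bop { bop_fun :> H -> H; bopP : bop_fun \in bounded_op }.

HB.instance Definition _ := [isSub for bop_fun].
HB.instance Definition _ := [Choice of bop by <:].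
HB.instance Definition _ := [SubChoice_isSubLmodule of bop by <:].

Lemma bop_linear (a : bop) : linear a.
Proof. by have /asboolP[] := bopP a. Qed.

HB.instance Definition _ (a : bop) :=
  GRing.isLinear.Build R[i] H H _ (bop_fun a) (bop_linear a).

Lemma bcomp_subproof (a b : bop) : (a \o b : H -> H) \in bounded_op.
Proof.
have /asboolP[la [M hM]] := bopP a; have /asboolP[lb [N hN]] := bopP b.
apply/asboolP; split; first by move=> k x y /=; rewrite lb la.
exists (`|M| * N) => x /=.
have M0 (y : H) : M * `|y| <= `|M| * `|y|.
  have h0 := le_trans (normr_ge0 _) (hM y).
  by rewrite -(ger0_norm h0) normrM normr_id.
by rewrite (le_trans (hM _))// (le_trans (M0 _))// -mulrA ler_wpM2l.
Qed.

Definition bcomp (a b : bop) : bop := Bop (bcomp_subproof a b).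

Definition finite_rank : {pred bop} := fun a =>
  `[< exists s : seq H, forall x, in_span s (a x) >].

Lemma finite_rank_submod : submod_closed finite_rank.
Proof.
split.
  by apply/asboolP; exists [::] => x; exists (fun=> 0); rewrite big_ord0.
move=> k a b /asboolP[s hs] /asboolP[t ht]; apply/asboolP; exists (s ++ t) => x.
have [c hc] := hs x; have [d hd] := ht x.
exists (fun j => if (j < size s)%N then k * c j else d (j - size s)%N).
rewrite size_cat big_split_ord /=.
rewrite -[LHS]/(k *: a x + b x).
rewrite hc hd scaler_sumr; congr (_ + _); apply: eq_bigr => j _ /=.
  by rewrite ltn_ord nth_cat ltn_ord scalerA.
by rewrite nth_cat ltnNge leq_addr /= addKn.
Qed.

HB.instance Definition _ :=
  GRing.isSubmodClosed.Build R[i] bop finite_rank finite_rank_submod.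

Record fop := Fop { fop_bop :> bop; fopP : fop_bop \in finite_rank }.

HB.instance Definition _ := [isSub for fop_bop].
HB.instance Definition _ := [Choice of fop by <:].
HB.instance Definition _ := [SubChoice_isSubLmodule of fop by <:].

Lemma fcompl_subproof (a : bop) (b : fop) : bcomp a b \in finite_rank.
Proof.
have /asboolP[s hs] := fopP b; apply/asboolP; exists (map a s) => x.
have [c hc] := hs x; exists c; rewrite /= hc linear_sum size_map /=.
by apply: eq_bigr => j _; rewrite linearZ /= (nth_map 0).
Qed.

Lemma fcompr_subproof (b : fop) (a : bop) : bcomp b a \in finite_rank.
Proof.
have /asboolP[s hs] := fopP b; apply/asboolP; exists s => x; exact: hs.
Qed.

Definition fcompl (a : bop) (b : fop) : fop := Fop (fcompl_subproof a b).
Definition fcompr (b : fop) (a : bop) : fop := Fop (fcompr_subproof b a).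

Definition opnorm (a : bop) : R :=
  sup [set rnorm (a x) | x in [set x : H | rnorm x <= 1]].

Definition is_projection (P : bop) : Prop :=
  (forall x, P (P x) = P x) /\ (forall x y, hdot H (P x) y = hdot H x (P y)).

Definition orthogonal_projections (P Q : bop) : Prop :=
  [/\ is_projection P, is_projection Q & forall x, P (Q x) = 0].

Definition rank_one_projection (p : fop) : Prop :=
  is_projection p /\
  exists2 v : H, v != 0 & range p = range (fun c : R[i] => c *: v).

End Operators.

Arguments bounded_op {R} H.

Section Diamond.
Variable R : realType.

(* The Hilbert tensor square, determined up to a unique unitary isomorphism
   compatible with the elementary tensors. *)
Record hilbert_square (L : hilbert R) := HilbertSquare {
  hsq :> hilbert R;
  htens : L -> L -> hsq;
  htens_bilinear : is_bilinear htens;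
  htens_dot : forall x y x' y',
    hdot hsq (htens x y) (htens x' y') = hdot L x x' * hdot L y y';
  htens_dense :
    dense [set h | exists s : seq (L * L), h = \sum_(p <- s) htens p.1 p.2] }.

Record unitary (H L : hilbert R) := Unitary {
  uni :> H -> L;
  uni_inv : L -> H;
  uni_linear : linear uni;
  uniK : cancel uni uni_inv;
  uni_invK : cancel uni_inv uni;
  uni_dot : forall x y, hdot L (uni x) (uni y) = hdot H x y }.

Section Conjugation.
Variables (H L : hilbert R) (iota : unitary H L).

Lemma uni_norm x : `|iota x| = `|x|.
Proof. by apply/eqP; rewrite -(@eqrXn2 _ 2)// !hdot_norm uni_dot. Qed.

Lemma unitary_conj_subproof (T : bop H) :
  (fun x : L => iota (T (uni_inv iota x))) \in bounded_op L.
Proof.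
have /asboolP[_ [M hM]] := bopP T.
have li : linear (uni_inv iota).
  by move=> k x y; apply: (can_inj (uniK iota)); rewrite uni_linear !uni_invK.
apply/asboolP; split.
  by move=> k x y; rewrite li linearP uni_linear.
by exists M => x; rewrite uni_norm -{2}(uni_invK iota x) uni_norm.
Qed.

Definition unitary_conj (T : bop H) : bop L := Bop (unitary_conj_subproof T).

End Conjugation.

Section DiamondDef.
Variables (L : hilbert R) (H : hilbert_square L) (iota : unitary H L).

(* The operator a ⊗ b is the unique bounded operator sending x ⊗ y to
   a x ⊗ b y; it always exists, so that the default value 0 is never used. *)
Definition htens_op (a b : bop L) : bop H :=
  xget 0 [set T : bop H | forall x y, T (htens H x y) = htens H (a x) (b y)].

Definition diamond (a b : bop L) : bop L := unitary_conj iota (htens_op a b).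

(* [diamond a b] has finite rank when a and b do: here too the default value 0
   is never used. *)
Definition fdiamond (a b : fop L) : fop L := insubd (0 : fop L) (diamond a b).

End DiamondDef.
End Diamond.

Section QSpaces.
Variables (R : realType) (L : hilbert R).

Definition ampl (E : lmodType R[i]) : lmodType R[i] := tens (fop L) E.

Definition lact (E : lmodType R[i]) (a : bop L) (u : ampl E) : ampl E :=
  tens_map (fcompl a) id u.
Definition ract (E : lmodType R[i]) (u : ampl E) (a : bop L) : ampl E :=
  tens_map (fun b => fcompr b a) id u.

Definition is_support (E : lmodType R[i]) (P : bop L) (u : ampl E) : Prop :=
  [/\ is_projection P, lact P u = u & ract u P = u].

Record is_qnorm (E : lmodType R[i]) (N : ampl E -> R) : Prop := IsQnorm {
  qnormD : forall u v, N (u + v) <= N u + N v;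
  qnormZ : forall (c : R[i]) u, N (c *: u) = rnorm (c : R[i]^o) * N u;
  qnorm_eq0 : forall u, N u = 0 -> u = 0;
  qnorm_bimod : forall (a b : bop L) u,
    N (ract (lact a u) b) <= opnorm a * N u * opnorm b;
  qnorm_max : forall (u v : ampl E) (P Q : bop L),
    is_support P u -> is_support Q v -> orthogonal_projections P Q ->
    N (u + v) = Num.max (N u) (N v) }.

Record qspace := Qspace {
  qcarrier :> lmodType R[i];
  qnorm : ampl qcarrier -> R;
  qnormP : is_qnorm qnorm }.

(* By the bimodule inequality the underlying norm does not depend on the chosen
   rank one projection. *)
Definition unorm (E : qspace) (x : E) : R :=
  qnorm (xget (0 : fop L) (@rank_one_projection R L) ⊗ x).

Definition ucvg (E : qspace) (f : nat -> E) (l : E) : Prop :=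
  forall eps : R, 0 < eps -> exists n, forall m, (n <= m)%N ->
    unorm (f m - l) < eps.

Definition ucauchy (E : qspace) (f : nat -> E) : Prop :=
  forall eps : R, 0 < eps -> exists n, forall m k, (n <= m)%N -> (n <= k)%N ->
    unorm (f m - f k) < eps.

Definition qcomplete (E : qspace) : Prop :=
  forall f : nat -> E, ucauchy f -> exists l, ucvg f l.

Record banach_qspace := BanachQspace {
  bq_space :> qspace;
  bq_complete : qcomplete bq_space }.

Definition ampl_map (E F : lmodType R[i]) (phi : E -> F) : ampl E -> ampl F :=
  tens_map id phi.

Lemma ampl_map_id (E : lmodType R[i]) (u : ampl E) : ampl_map id u = u.
Proof. by rewrite /ampl_map /tens_map /tlift -tens_sum. Qed.

Lemma ampl_map_linear (E F : lmodType R[i]) (phi : E -> F) :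
  linear phi -> linear (ampl_map phi).
Proof. by move=> lphi; apply: tens_map_linear => // k x y. Qed.

Lemma ampl_map_comp (E F G : lmodType R[i]) (psi : F -> G) (phi : E -> F) :
  linear psi -> linear phi -> forall u,
  ampl_map (psi \o phi) u = ampl_map psi (ampl_map phi u).
Proof.
move=> lpsi lphi u.
have lc : linear (psi \o phi) by move=> k x y /=; rewrite lphi lpsi.
rewrite -[RHS]/((ampl_map psi \o ampl_map phi) u).
congr (_ u); apply: tens_ext; first exact: ampl_map_linear.
  by move=> k x y /=; rewrite !ampl_map_linear.
by move=> a x /=; rewrite /ampl_map !tens_mapE// => k y z.
Qed.

Definition completely_bounded (E F : qspace) (phi : E -> F) : Prop :=
  exists M : R, forall u, qnorm (ampl_map phi u) <= M * qnorm u.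

Record cb_map (E F : qspace) := CbMap {
  cb_fun :> E -> F;
  cb_linear : linear cb_fun;
  cb_bounded : completely_bounded cb_fun }.

HB.instance Definition _ (E F : qspace) (phi : cb_map E F) :=
  GRing.isLinear.Build R[i] E F _ (cb_fun phi) (cb_linear phi).

Lemma cb_map_ext (E F : qspace) (phi psi : cb_map E F) :
  phi =1 psi -> phi = psi.
Proof.
case: phi psi => [f lf bf] [g lg bg] /= /funext fg; subst g.
by congr CbMap; exact: Prop_irrelevance.
Qed.

Lemma cb_id_subproof (E : qspace) : completely_bounded (@id E).
Proof. by exists 1 => u; rewrite ampl_map_id mul1r. Qed.

Definition cb_id (E : qspace) : cb_map E E :=
  CbMap (fun _ _ _ => erefl) (cb_id_subproof E).

Lemma cb_comp_linear (E F G : qspace) (psi : cb_map F G) (phi : cb_map E F) :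
  linear (psi \o phi).
Proof. by move=> k x y /=; rewrite !linearP. Qed.

Lemma qnorm_ge0 (E : qspace) (u : ampl E) : 0 <= qnorm u.
Proof.
have hN := qnormP E.
have h0 : qnorm (0 : ampl E) = 0.
  by rewrite -(scale0r (0 : ampl E)) (qnormZ hN) /rnorm normr0 mul0r.
have hopp : qnorm (- u) = qnorm u.
  by rewrite -scaleN1r (qnormZ hN) /rnorm normrN1 mul1r.
by have := qnormD hN u (- u); rewrite subrr h0 hopp -mulr2n pmulrn_lge0.
Qed.

Lemma cb_comp_subproof (E F G : qspace) (psi : cb_map F G) (phi : cb_map E F) :
  completely_bounded (psi \o phi).
Proof.
have [M hM] := cb_bounded psi; have [N hN] := cb_bounded phi.
exists (Num.max M 0 * N) => u; rewrite ampl_map_comp; try exact: cb_linear.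
rewrite (le_trans (hM _))// -mulrA (@le_trans _ _ (Num.max M 0 * qnorm (ampl_map phi u)))//.
  by rewrite ler_wpM2r ?qnorm_ge0// le_max lexx.
by rewrite ler_wpM2l// le_max lexx orbT.
Qed.

Definition cb_comp (E F G : qspace) (psi : cb_map F G) (phi : cb_map E F) :
  cb_map E G := CbMap (cb_comp_linear psi phi) (cb_comp_subproof psi phi).

End QSpaces.

Section QModules.
Variables (R : realType) (L : hilbert R) (H : hilbert_square L).
Variable iota : unitary H L.

Local Notation ampl := (ampl L).
Local Notation qspace := (qspace L).
Local Notation banach_qspace := (banach_qspace L).

Definition ampl_bil (E F G : lmodType R[i]) (B : E -> F -> G)
    (u : ampl E) (v : ampl F) : ampl G :=
  tlift (fun a x => tlift (fun b y => fdiamond iota a b ⊗ B x y) v) u.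

Definition completely_contractive (E F G : qspace) (B : E -> F -> G) : Prop :=
  forall (u : ampl E) (v : ampl F), qnorm (ampl_bil B u v) <= qnorm u * qnorm v.

Record qalgebra := Qalgebra {
  qa_space :> qspace;
  qmul : qa_space -> qa_space -> qa_space;
  qmul_bilinear : is_bilinear qmul;
  qmulA : associative qmul;
  qmul_cc : completely_contractive qmul }.

Definition is_identity (A : qalgebra) (e : A) : Prop :=
  left_id e (@qmul A) /\ right_id e (@qmul A).

Record is_qmodule (A : qalgebra) (e : A) (X : qspace) (act : A -> X -> X) :
    Prop := IsQmodule {
  act_bilinear : is_bilinear act;
  actA : forall a b x, act (qmul a b) x = act a (act b x);
  act1 : forall x, act e x = x;
  act_cc : completely_contractive act }.

Record banach_qmodule (A : qalgebra) (e : A) := BanachQmodule {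
  qm_space :> banach_qspace;
  qact : A -> qm_space -> qm_space;
  qactP : is_qmodule e qact }.

Section Morphisms.
Variables (A : qalgebra) (e : A).

Record qmod_hom (X Y : banach_qmodule e) := QmodHom {
  qh_map :> cb_map X Y;
  qh_act : forall a x, qh_map (qact a x) = qact a (qh_map x) }.

Lemma qmod_hom_ext (X Y : banach_qmodule e) (f g : qmod_hom X Y) :
  f =1 g -> f = g.
Proof.
case: f g => [f hf] [g hg] /= /cb_map_ext fg; subst g.
by congr QmodHom; exact: Prop_irrelevance.
Qed.

Definition qh_id (X : banach_qmodule e) : qmod_hom X X :=
  @QmodHom X X (cb_id X) (fun _ _ => erefl).

Lemma qh_comp_subproof (X Y Z : banach_qmodule e)
    (g : qmod_hom Y Z) (f : qmod_hom X Y) a x :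
  cb_comp g f (qact a x) = qact a (cb_comp g f x).
Proof. by rewrite /= !qh_act. Qed.

Definition qh_comp (X Y Z : banach_qmodule e)
    (g : qmod_hom Y Z) (f : qmod_hom X Y) : qmod_hom X Z :=
  QmodHom (qh_comp_subproof g f).

End Morphisms.

Definition diamond_tens (E F : lmodType R[i]) (u : ampl E) (v : ampl F) :
  ampl (tens E F) := ampl_bil (@pure _ E F) u v.

Definition op_norm (E F : qspace) (U : ampl (tens E F)) : R :=
  inf [set r | exists (a b : fop L) (u : ampl E) (v : ampl F),
    U = ract (lact a (diamond_tens u v)) b /\
    r = opnorm a * qnorm u * qnorm v * opnorm b].

(* A completion of the Q-space (E ⊗ F, op_norm): unique up to a unique completely
   isometric isomorphism, hence a record rather than a particular model. *)
Record op_completion (E F : qspace) := OpCompletion {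
  oc_space :> banach_qspace;
  oc_in : tens E F -> oc_space;
  oc_linear : linear oc_in;
  oc_isometric : forall U : ampl (tens E F),
    qnorm (ampl_map oc_in U) = op_norm U;
  oc_dense : forall (x : oc_space) (eps : R), 0 < eps ->
    exists t, unorm (oc_in t - x) < eps }.

Definition oc_pure (E F : qspace) (X : op_completion E F) (x : E) (y : F) : X :=
  oc_in X (x ⊗ y).

End QModules.

Record category := Category {
  obj :> Type;
  hom : obj -> obj -> Type;
  idm : forall X, hom X X;
  compm : forall X Y Z, hom Y Z -> hom X Y -> hom X Z;
  compmA : forall X Y Z W (h : hom Z W) (g : hom Y Z) (f : hom X Y),
    compm h (compm g f) = compm (compm h g) f;
  comp1m : forall X Y (f : hom X Y), compm (idm Y) f = f;
  compm1 : forall X Y (f : hom X Y), compm f (idm X) = f }.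

Record functor (C D : category) := Functor {
  fobj :> C -> D;
  fmap : forall X Y, hom X Y -> hom (fobj X) (fobj Y);
  fmap1 : forall X, fmap (idm X) = idm (fobj X);
  fmapM : forall X Y Z (g : hom Y Z) (f : hom X Y),
    fmap (compm g f) = compm (fmap g) (fmap f) }.

Record rigged_category := RiggedCategory {
  rig_total : category;
  rig_base : category;
  rig_forget :> functor rig_total rig_base;
  rig_faithful : forall X Y, injective (@fmap _ _ rig_forget X Y) }.

Record free_structure (K : rigged_category) (M : rig_base K) (Fr : rig_total K) :=
  FreeStructure {
    free_map :> forall X : rig_total K, hom M (K X) -> hom Fr X;
    free_bij : forall X, bijective (@free_map X);
    free_nat : forall (X Y : rig_total K) (g : hom X Y) (f : hom M (K X)),
      free_map (compm (fmap K g) f) = compm g (free_map f) }.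

Section Categories.
Variables (R : realType) (L : hilbert R).

Definition QBan : category.
Proof.
refine (@Category (banach_qspace L) (fun E F => cb_map E F)
  (fun E => cb_id E) (fun E F G psi phi => cb_comp psi phi) _ _ _).
- by move=> *; exact: cb_map_ext.
- by move=> *; exact: cb_map_ext.
- by move=> *; exact: cb_map_ext.
Defined.

Variables (H : hilbert_square L) (iota : unitary H L).
Variables (A : qalgebra iota) (e : A).

Definition QAmod : category.
Proof.
refine (@Category (banach_qmodule e) (@qmod_hom _ _ _ _ _ _)
  (@qh_id _ _ _ _ _ _) (@qh_comp _ _ _ _ _ _) _ _ _).
- by move=> *; exact: qmod_hom_ext.
- by move=> *; exact: qmod_hom_ext.
- by move=> *; exact: qmod_hom_ext.
Defined.

Definition QAmod_forget : functor QAmod QBan.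
Proof.
refine (@Functor QAmod QBan (fun X : banach_qmodule e => X : banach_qspace L)
  (fun X Y (f : qmod_hom X Y) => f : cb_map X Y) _ _).
- by [].
- by [].
Defined.

Lemma QAmod_forget_faithful X Y : injective (@fmap _ _ QAmod_forget X Y).
Proof.
move=> f g fg; apply: (@qmod_hom_ext _ _ _ _ _ _ X Y) => x.
exact: (congr1 (fun h : cb_map _ _ => h x) fg).
Qed.

Definition QAmod_rigged : rigged_category :=
  RiggedCategory QAmod_forget_faithful.

End Categories.

(* Main.v *)
Require Import Defs.
From HB Require Import structures.
From mathcomp Require Import all_boot all_order all_algebra.
From mathcomp Require Import all_classical all_reals all_analysis.
From mathcomp Require Import complex.
From mathcomp Require Import ring lra.

Set Implicit Arguments.
Unset Strict Implicit.
Unset Printing Implicit Defensive.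

Import Order.TTheory GRing.Theory Num.Theory.
Import numFieldNormedType.Exports.

Local Open Scope classical_set_scope.
Local Open Scope ring_scope.

(** The proof has a Hilbert space half and a Q-space half.

   The Q-space half is soft. If [φ : E -> Y] is completely bounded, then
   [a ⊗ x |-> a·φ(x)] defines a linear map [f] on [A ⊗ E], and its amplification
   sends [a·(u ♦ v)·b] to [a·(u·φ_∞(v))·b], where [u·w] is the amplified outer
   multiplication of [Y]. Since this multiplication is completely contractive,
   the norm of the image is at most [‖φ‖_cb ‖a‖ ‖u‖ ‖v‖ ‖b‖]; the infimum over
   all representations gives [‖f_∞(U)‖ <= ‖φ‖_cb ‖U‖_op]. Hence [f] extends to
   the completion ([completion_extension]), with the same bound on all
   amplifications ([completion_bound]); the extension is a module map because it
   is one on elementary tensors, which also determine it ([completion_eq]).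
   Conversely a morphism [S] is recovered from [x |-> S(e ⊗ x)], and this is
   completely bounded because [x |-> e ⊗ x] is ([free_unit]). The two passages
   are mutually inverse and natural by [completion_eq] again.

   The module structure itself needs one sharp estimate ([tens_act_bound]):
   [‖w ♦ U‖_op <= ‖w‖ ‖U‖_op], after multiplication in [A], for [w ∈ FA] and
   [U ∈ F(A ⊗ E)]. For [U = a·(u ♦ v)·b] the element [w ♦ U] equals
   [((1 ♦ a)W)·((wu) ♦ v)·(V(1 ♦ b))], where [wu] is the amplified product and
   [V], [W] are contractions relating the operators [(a ♦ b) ♦ c] and
   [a ♦ (b ♦ c)] ([tens_act_representation]).

   The Hilbert space half supplies what these arguments use: the existence of
   [a ♦ b] and [‖a ♦ b‖ <= ‖a‖ ‖b‖] ([ts_bound]); the fact that [a ♦ b] has finite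
   rank when [a] and [b] do, by the Riesz theorem ([riesz], [fop_ketbra]); the
   contractions [V] and [W] ([diamond_assoc]); finite rank contractive supports
   ([biact_support]), which give [‖u ♦ v‖_op <= ‖u‖ ‖v‖]; and the existence of a
   representation [a·(u ♦ v)·b] for each tensor ([op_representation]), for which
   [L] has to be infinite dimensional. All operators which are not given by a
   formula come from [bounded_extension]. *)

(** * Linear maps and real-valued norms *)

Section LinearFacts.
Variables (K : nzRingType) (V W : lmodType K) (f : V -> W).
Hypothesis lf : linear f.

Lemma linD x y : f (x + y) = f x + f y.
Proof. by rewrite -{1}[x]scale1r lf scale1r. Qed.

Lemma lin0 : f 0 = 0.
Proof. by apply: (addrI (f 0)); rewrite -linD !addr0. Qed.

Lemma linZ c x : f (c *: x) = c *: f x.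
Proof. by rewrite -[c *: x]addr0 lf lin0 addr0. Qed.

Lemma linN x : f (- x) = - f x.
Proof. by rewrite -!scaleN1r linZ. Qed.

Lemma linB x y : f (x - y) = f x - f y.
Proof. by rewrite linD linN. Qed.

Lemma lin_sum (I : Type) (r : seq I) (F : I -> V) :
  f (\sum_(i <- r) F i) = \sum_(i <- r) f (F i).
Proof. by apply: (big_morph f); [exact: linD | exact: lin0]. Qed.

End LinearFacts.

Section AbstractNorm.
Variable R : realType.
Local Notation C := R[i].

Definition cabs (c : C) : R := complex.Re `|c|.

Lemma cabsE (c : C) : (cabs c)%:C%C = `|c|.
Proof. by rewrite /cabs RRe_real// normr_real. Qed.

Lemma cabs_ge0 (c : C) : 0 <= cabs c.
Proof. by rewrite -ler0c cabsE. Qed.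

Lemma cabs_nneg (r : R) : 0 <= r -> cabs r%:C%C = r.
Proof. by move=> r0; rewrite /cabs ger0_norm ?ler0c. Qed.

(** Real-valued, so that the norm of a Hilbert space and the underlying norm of a
   Q-space, which have different codomains, are treated by the same lemmas. *)
Record is_norm (V : lmodType C) (N : V -> R) : Prop := IsNorm {
  is_normD : forall x y, N (x + y) <= N x + N y;
  is_normZ : forall (c : C) x, N (c *: x) = cabs c * N x;
  is_norm_eq0 : forall x, N x = 0 -> x = 0 }.

Definition norm_complete (V : lmodType C) (N : V -> R) : Prop :=
  forall f : nat -> V,
    (forall eps : R, 0 < eps -> exists n, forall m k, (n <= m)%N -> (n <= k)%N ->
       N (f m - f k) < eps) ->
    exists l, forall eps : R, 0 < eps -> exists n, forall m, (n <= m)%N ->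
      N (f m - l) < eps.

Section NormTheory.
Variables (V : lmodType C) (N : V -> R).
Hypothesis hN : is_norm N.

Lemma is_norm0 : N 0 = 0.
Proof. by rewrite -(scale0r (0 : V)) (is_normZ hN) /cabs normr0 mul0r. Qed.

Lemma is_normN x : N (- x) = N x.
Proof. by rewrite -scaleN1r (is_normZ hN) /cabs normrN1 mul1r. Qed.

Lemma is_normB x y : N (x - y) = N (y - x).
Proof. by rewrite -is_normN opprB. Qed.

Lemma is_norm_ge0 x : 0 <= N x.
Proof.
have := is_normD hN x (- x).
by rewrite subrr is_norm0 is_normN -mulr2n pmulrn_lge0.
Qed.

Lemma is_norm_tri x y z : N (x - z) <= N (x - y) + N (y - z).
Proof. by rewrite -[x - z](subrKA y) (is_normD hN). Qed.

Lemma is_norm_small x : (forall eps : R, 0 < eps -> N x <= eps) -> x = 0.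
Proof.
move=> h; apply: (is_norm_eq0 hN); apply/eqP; rewrite eq_le is_norm_ge0 andbT.
by apply/ler_addgt0Pl => e e0; rewrite addr0 h.
Qed.

Lemma is_norm_leD x y : N x <= N y + N (x - y).
Proof. by rewrite -{1}(subrK y x) addrC (is_normD hN). Qed.

Lemma is_norm_sum (I : Type) (r : seq I) (F : I -> V) :
  N (\sum_(i <- r) F i) <= \sum_(i <- r) N (F i).
Proof.
elim: r => [|i r IH]; first by rewrite !big_nil is_norm0.
by rewrite !big_cons (le_trans (is_normD hN _ _))// lerD2l.
Qed.

End NormTheory.

Lemma small_factor (M eps : R) : 0 < eps ->
  exists2 d, 0 < d & M * d <= eps.
Proof.
move=> e0; exists (eps / (`|M| + 1)); first by rewrite divr_gt0// ltr_wpDl.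
have M0 : 0 < `|M| + 1 by rewrite ltr_wpDl.
rewrite mulrCA ler_piMr ?(ltW e0)// ler_pdivrMr// mul1r.
by rewrite (le_trans (ler_norm M))// lerDl.
Qed.

(** The inequality is closed: it passes to joint limits of its two arguments. *)
Lemma limit_bound (V W : lmodType C) (NV : V -> R) (NW : W -> R) (M : R) x y :
  is_norm NV -> is_norm NW ->
  (forall eps : R, 0 < eps -> exists x' y',
    [/\ NW y' <= M * NV x', NV (x' - x) < eps & NW (y' - y) < eps]) ->
  NW y <= M * NV x.
Proof.
move=> hV hW h; apply/ler_addgt0Pl => e e0.
have [d d0 hd] := small_factor (`|M| + 1) e0.
have [u [v [g1 g2 g3]]] := h _ d0.
have h1 : NW y <= NW v + d.
  by rewrite (le_trans (is_norm_leD hW y v))// lerD2l (is_normB hW) ltW.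
rewrite (le_trans h1)// (le_trans _ (lerD hd (lexx _)))//.
rewrite mulrDl mul1r addrAC lerD2r (le_trans g1)//.
have -> : M * NV u = M * (NV u - NV x) + M * NV x by rewrite -mulrDr subrK.
rewrite lerD2r (le_trans (ler_norm _))// normrM ler_wpM2l//.
rewrite ler_norml lerBlDl (le_trans (is_norm_leD hV u x)) ?lerD2l ?(ltW g2)// andbT.
rewrite lerBrDl lerBlDr (le_trans (is_norm_leD hV x u))// lerD2l.
by rewrite (is_normB hV) ltW.
Qed.

Lemma invS_small (eps : R) : 0 < eps ->
  exists n, forall m, (n <= m)%N -> (m.+1%:R^-1 : R) < eps.
Proof.
move=> e0; have [n hn] := ltr_add_invr (y := 0) e0.
exists n => m nm; rewrite add0r in hn; apply: le_lt_trans hn.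
by rewrite lef_pV2 ?posrE// ler_nat ltnS.
Qed.

(** Extension by continuity, for a map which is given by its graph [G]: in the
   applications the arguments are linear combinations of a family, and two
   combinations may be equal without having the same coefficients. The closure
   of [G] is linear and satisfies the bound, hence is single-valued; completeness
   makes it everywhere defined. *)
Section Extension.
Variables (V W : lmodType C) (NV : V -> R) (NW : W -> R).
Hypotheses (hV : is_norm NV) (hW : is_norm NW) (cW : norm_complete NW).
Variables (G : V -> W -> Prop) (M : R).
Hypotheses
  (G_lin : forall (c : C) x y x' y', G x y -> G x' y' ->
     G (c *: x + x') (c *: y + y'))
  (G_bound : forall x y, G x y -> NW y <= M * NV x)
  (G_dense : forall x (eps : R), 0 < eps -> exists x' y', G x' y' /\ NV (x' - x) < eps).

Let Gc x y := forall eps : R, 0 < eps ->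
  exists x' y', [/\ G x' y', NV (x' - x) < eps & NW (y' - y) < eps].

Let Gc_lin c x y x' y' : Gc x y -> Gc x' y' -> Gc (c *: x + x') (c *: y + y').
Proof.
move=> h h' e e0.
have [d d0 hd] := small_factor (cabs c + 1) e0.
have [u [v [g1 g2 g3]]] := h _ d0; have [u' [v' [g1' g2' g3']]] := h' _ d0.
exists (c *: u + u'), (c *: v + v'); split; first exact: G_lin.
- rewrite opprD addrACA -scalerBr.
  rewrite (le_lt_trans (is_normD hV _ _))// (is_normZ hV) (lt_le_trans _ hd)//.
  by rewrite mulrDl mul1r ler_ltD// ler_wpM2l ?cabs_ge0// ltW.
- rewrite opprD addrACA -scalerBr.
  rewrite (le_lt_trans (is_normD hW _ _))// (is_normZ hW) (lt_le_trans _ hd)//.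
  by rewrite mulrDl mul1r ler_ltD// ler_wpM2l ?cabs_ge0// ltW.
Qed.

Let Gc_bound x y : Gc x y -> NW y <= M * NV x.
Proof.
move=> h; apply: limit_bound hV hW _ => e e0.
by have [x' [y' [g gx gy]]] := h e e0; exists x', y'; split=> //; exact: G_bound.
Qed.

Let Gc_fun x y y' : Gc x y -> Gc x y' -> y = y'.
Proof.
move=> h h'; have := Gc_bound (Gc_lin (-1) h h').
rewrite !scaleN1r addNr (is_norm0 hV) mulr0 => h0.
have /(is_norm_eq0 hW) : NW (- y + y') = 0.
  by apply/eqP; rewrite eq_le h0 is_norm_ge0.
by move/eqP; rewrite addrC subr_eq0 => /eqP ->.
Qed.

Let Gc_total x : exists y, Gc x y.
Proof.
have pos n : 0 < (n.+1%:R : R)^-1 by [].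
have /choice [f hf] : forall n, exists p : V * W,
    G p.1 p.2 /\ NV (p.1 - x) < n.+1%:R^-1.
  by move=> n; have [u [v g]] := G_dense x (pos n); exists (u, v).
have [e e0|l hl] := cW (f := fun n => (f n).2).
  have [d d0 hd] := small_factor (`|M| + 1) (divr_gt0 e0 (ltr0Sn R 1)).
  have [n hn] := invS_small d0; exists n => m k nm nk.
  have [g1 g2] := hf m; have [g1' g2'] := hf k.
  have := G_bound (G_lin (-1) g1' g1); rewrite !scaleN1r addrC => /le_lt_trans; apply.
  have h : NV (- (f k).1 + (f m).1) <= 2%:R * d.
    rewrite addrC (le_trans (is_norm_tri hV _ x _))// mulrDl mul1r lerD// ltW//.
      by apply: lt_trans (hn _ nm).
    by rewrite (is_normB hV); apply: lt_trans (hn _ nk).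
  rewrite (@le_lt_trans _ _ (`|M| * (2%:R * d)))//.
    apply: le_trans (ler_wpM2l (normr_ge0 M) h).
    by rewrite ler_wpM2r ?is_norm_ge0// ler_norm.
  have h2 : `|M| * d < e / 2%:R.
    by apply: lt_le_trans hd; rewrite mulrDl mul1r ltrDl.
  by rewrite mulrCA mulrC -ltr_pdivlMr.
exists l => e e0; have [n hn] := invS_small e0; have [n' hn'] := hl _ e0.
have [g1 g2] := hf (maxn n n'); exists (f (maxn n n')).1, (f (maxn n n')).2; split=> //.
  by apply: lt_trans g2 _; apply: hn; rewrite leq_maxl.
by apply: hn'; rewrite leq_maxr.
Qed.

Lemma bounded_extension : exists T : V -> W,
  [/\ linear T, forall x y, G x y -> T x = y & forall x, NW (T x) <= M * NV x].
Proof.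
have /choice [T hT] := Gc_total; exists T; split.
- by move=> c x y; apply: Gc_fun (hT _) _; apply: Gc_lin.
- move=> x y g; apply: Gc_fun (hT _) _ => e e0; exists x, y.
  by rewrite !subrr (is_norm0 hV) (is_norm0 hW).
- by move=> x; apply: Gc_bound.
Qed.

End Extension.

Lemma dense_eq (V W : lmodType C) (NV : V -> R) (NW : W -> R) (D : V -> Prop)
    (S T : V -> W) (M M' : R) : is_norm NV -> is_norm NW ->
  linear S -> linear T ->
  (forall x, NW (S x) <= M * NV x) -> (forall x, NW (T x) <= M' * NV x) ->
  (forall x (eps : R), 0 < eps -> exists2 x', D x' & NV (x' - x) < eps) ->
  (forall x, D x -> S x = T x) -> S =1 T.
Proof.
move=> hV hW lS lT bS bT dD ST x; apply/eqP; rewrite -subr_eq0; apply/eqP.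
apply: (is_norm_small hW) => e e0.
have [d d0 hd] := small_factor (`|M| + `|M'|) e0.
have [x' Dx' hx'] := dD x _ d0.
have -> : S x - T x = T (x' - x) - S (x' - x).
  have -> : x' - x = -1 *: x + x' by rewrite scaleN1r addrC.
  rewrite lS lT (ST x')// !scaleN1r.
  by rewrite opprD opprK addrACA subrr addr0 addrC.
rewrite (le_trans (is_normD hW _ _))// (is_normN hW) (le_trans _ hd)//.
rewrite mulrDl addrC.
have key Q : Q * NV (x' - x) <= `|Q| * d.
  apply: le_trans (ler_wpM2l (normr_ge0 Q) (ltW hx')).
  by rewrite ler_wpM2r ?is_norm_ge0// ler_norm.
by rewrite lerD// (le_trans _ (key _)).
Qed.

End AbstractNorm.

(** * Hilbert spaces: orthonormal systems *)

Section Hilbert.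
Variables (R : realType) (H : hilbert R).
Local Notation C := R[i].
Local Notation "''[' x , y ]" := (hdot H x y) : ring_scope.
Implicit Types (x y z : H).

Lemma rnormE x : (rnorm x)%:C%C = `|x|.
Proof. by rewrite /rnorm RRe_real// normr_real. Qed.

Lemma rnorm_le x (M : R) : (rnorm x <= M) = (`|x| <= M%:C%C).
Proof. by rewrite -rnormE lecR. Qed.

Lemma rnorm_is_norm : is_norm (fun x : H => rnorm x).
Proof.
split=> [x y|c x|x].
- by rewrite -lecR rmorphD /= !rnormE ler_normD.
- by apply: complexI; rewrite rmorphM /= !rnormE normrZ cabsE.
- by move=> x0; apply/eqP; rewrite -normr_eq0 -rnormE x0.
Qed.

Lemma rnorm_complete : norm_complete (fun x : H => rnorm x).
Proof.
move=> f hf.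
have cf : cauchy (f @ \oo).
  apply: cauchy_exP => e e0.
  have er : e \is Num.real by rewrite gtr0_real.
  have e0' : 0 < complex.Re e by rewrite -(ltcR 0) RRe_real.
  have [n hn] := hf _ e0'.
  exists (f n); exists n => // m /= nm.
  by rewrite -ball_normE /= -rnormE -(RRe_real er) ltcR hn.
have /cauchy_cvgP/cvgrPdist_lt hl := cf.
exists (lim (f @ \oo)) => e e0.
have e0' : 0 < e%:C%C by rewrite (ltcR 0).
have [n _ hn] := hl _ e0'.
by exists n => m nm; rewrite -ltcR rnormE distrC; apply: hn.
Qed.

Lemma dotC x y : '[x, y] = ('[y, x])^*.
Proof. by rewrite hermC expr0 mul1r. Qed.

Lemma dot_eq0C x y : '[x, y] = 0 -> '[y, x] = 0.
Proof. by move=> h; rewrite dotC h rmorph0. Qed.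

Lemma rnorm_eq_dot x y : '[x, x] = '[y, y] -> rnorm x = rnorm y.
Proof.
move=> h; apply: complexI; rewrite !rnormE; apply/eqP.
by rewrite -(@eqrXn2 _ 2)// !hdot_norm h.
Qed.

Lemma rnorm_sqr x : ((rnorm x) ^+ 2)%:C%C = '[x, x].
Proof. by rewrite rmorphXn /= rnormE hdot_norm. Qed.

Lemma rnorm_ge0 x : 0 <= rnorm x.
Proof. exact: (is_norm_ge0 rnorm_is_norm). Qed.

Lemma rnormZ (c : C) x : rnorm (c *: x) = cabs c * rnorm x.
Proof. exact: (is_normZ rnorm_is_norm). Qed.

Lemma rnorm_neq0 x : x != 0 -> rnorm x != 0.
Proof. by apply: contra => /eqP/(is_norm_eq0 rnorm_is_norm) ->. Qed.

Lemma rnorm_normalize x : x != 0 -> rnorm (((rnorm x)^-1)%:C%C *: x) = 1.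
Proof.
by move=> x0; rewrite rnormZ cabs_nneg ?invr_ge0 ?rnorm_ge0// mulVf ?rnorm_neq0.
Qed.

Lemma dot_unit x : rnorm x = 1 -> '[x, x] = 1.
Proof. by move=> x1; rewrite -rnorm_sqr x1 expr1n. Qed.

(** A system of [n] vectors is a sequence of which only the first [n] terms matter,
   so that Gram-Schmidt can append a vector without changing the type. *)
Definition orthonormal_upto n (f : nat -> H) :=
  forall i j, (i < n)%N -> (j < n)%N -> '[f i, f j] = (i == j)%:R.

Definition oproj n (f : nat -> H) x := \sum_(i < n) '[x, f i] *: f i.

Lemma oproj_linear n f : linear (oproj n f).
Proof.
move=> c x y; rewrite /oproj scaler_sumr -big_split /=; apply: eq_bigr => i _.
by rewrite linearPl /= scalerDl scalerA.
Qed.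

Lemma dot_comb n f (c : nat -> C) j : orthonormal_upto n f -> (j < n)%N ->
  '[\sum_(i < n) c i *: f i, f j] = c j.
Proof.
move=> of_ jn; rewrite linear_sumlz (bigD1 (Ordinal jn)) //= big1 => [|i ij].
  by rewrite linearZl_LR /= of_// eqxx mulr1 addr0.
rewrite linearZl_LR /= of_//; case: eqP => [e|_]; last by rewrite mulr0.
by move/eqP: ij => []; apply: val_inj.
Qed.

Lemma oproj_comb n f (c : nat -> C) : orthonormal_upto n f ->
  oproj n f (\sum_(i < n) c i *: f i) = \sum_(i < n) c i *: f i.
Proof. by move=> of_; apply: eq_bigr => i _; rewrite dot_comb. Qed.

Lemma oproj_idem n f x : orthonormal_upto n f ->
  oproj n f (oproj n f x) = oproj n f x.
Proof. exact: (oproj_comb (fun i => '[x, f i])). Qed.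

Lemma oproj_sym n f x y : '[oproj n f x, y] = '[x, oproj n f y].
Proof.
rewrite linear_sumlz linear_sumr; apply: eq_bigr => i _.
by rewrite linearZl_LR linearZr_LR /= (dotC (f i) y) mulrC.
Qed.

Lemma oproj_orth n f x : orthonormal_upto n f ->
  '[x - oproj n f x, oproj n f x] = 0.
Proof.
by move=> of_; rewrite linearBl /= oproj_sym oproj_idem// subrr.
Qed.

Lemma oproj_contract n f x : orthonormal_upto n f ->
  rnorm (oproj n f x) <= rnorm x.
Proof.
move=> of_; rewrite -(@ler_pXn2r _ 2)// ?nnegrE ?rnorm_ge0// -lecR !rnorm_sqr.
rewrite -{3 4}(subrK (oproj n f x) x) (hnormDd (oproj_orth x of_)).
by rewrite lerDr dnorm_ge0.
Qed.

(** The contractivity of the projection on the line through [y]. *)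
Lemma cauchy_schwarz x y : cabs '[x, y] <= rnorm x * rnorm y.
Proof.
have [->|y0] := eqVneq y 0.
  by rewrite linear0r /cabs normr0 mulr_ge0 ?rnorm_ge0.
have ny : rnorm y != 0 by exact: rnorm_neq0.
pose f (i : nat) := ((rnorm y)^-1)%:C%C *: y.
have f1 : rnorm (f 0%N) = 1 by exact: rnorm_normalize.
have of_ : orthonormal_upto 1 f by move=> [|//] [|//] _ _; exact: dot_unit.
have E : oproj 1 f x = '[x, f 0%N] *: f 0%N by rewrite /oproj big_ord1.
have := oproj_contract x of_; rewrite E rnormZ f1.
rewrite mulr1 linearZr_LR /= /cabs normrM norm_conjC.
rewrite [X in X * _]ger0_norm ?ler0c ?invr_ge0 ?rnorm_ge0//.
rewrite -cabsE -rmorphM /= mulrC ler_pdivrMr ?lt_def ?ny ?rnorm_ge0//.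
Qed.

Lemma gram_schmidt_step n f v : orthonormal_upto n f -> oproj n f v <> v ->
  exists w, [/\ orthonormal_upto n.+1 (fun i => if (i < n)%N then f i else w),
    (forall i, (i < n)%N -> '[f i, w] = 0) &
    exists c, v = oproj n f v + c *: w].
Proof.
move=> of_ hv; pose u := v - oproj n f v.
have u0 : u != 0 by rewrite subr_eq0; apply/eqP => h; apply: hv.
have nu : rnorm u != 0 by exact: rnorm_neq0.
have fu i : (i < n)%N -> '[f i, u] = 0.
  move=> ni; apply: dot_eq0C; rewrite /u linearBl /= /oproj.
  by rewrite (dot_comb (fun i => '[v, f i]) of_ ni) subrr.
pose w := ((rnorm u)^-1)%:C%C *: u.
have fw i : (i < n)%N -> '[f i, w] = 0.
  by move=> ni; rewrite linearZr_LR /= fu// mulr0.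
have ww : '[w, w] = 1 by apply: dot_unit; exact: rnorm_normalize.
exists w; split=> //.
- move=> i j; rewrite !ltnS => hi hj.
  case: (ltnP i n) => hi'; case: (ltnP j n) => hj'.
  + exact: of_.
  + by rewrite fw// (ltn_eqF (leq_trans hi' hj')).
  + by rewrite (dot_eq0C (fw _ hj')) gtn_eqF// (leq_trans hj' hi').
  + have -> : i = n by apply/eqP; rewrite eqn_leq hi hi'.
    have -> : j = n by apply/eqP; rewrite eqn_leq hj hj'.
    by rewrite ww eqxx.
- exists (rnorm u)%:C%C; rewrite scalerA -rmorphM /= divff// scale1r.
  by rewrite /u addrC subrK.
Qed.

Lemma oproj_step n f w v :
  oproj n.+1 (fun i => if (i < n)%N then f i else w) v =
  oproj n f v + '[v, w] *: w.
Proof.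
rewrite /oproj big_ord_recr /= ltnn; congr (_ + _).
by apply: eq_bigr => i _; rewrite ltn_ord.
Qed.

Lemma gram_schmidt (s : seq H) :
  exists n f, orthonormal_upto n f /\ forall v, v \in s -> oproj n f v = v.
Proof.
elim: s => [|v s [n [f [of_ fs]]]]; first by exists 0%N, (fun=> 0).
have [fv|fv] := pselect (oproj n f v = v).
  by exists n, f; split=> // u; rewrite inE => /orP[/eqP->|/fs].
have [w [ow fw [c vE]]] := gram_schmidt_step of_ fv.
exists n.+1, (fun i => if (i < n)%N then f i else w); split=> // u.
have pw x : '[oproj n f x, w] = 0.
  by rewrite linear_sumlz big1// => i _; rewrite linearZl_LR /= fw// mulr0.
have ww : '[w, w] = 1.
  by have := ow n n (leqnn _) (leqnn _); rewrite ltnn eqxx.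
rewrite inE oproj_step => /orP[/eqP->|us].
  rewrite [in '[_, _]]vE linearDl /= pw add0r linearZl_LR /= ww mulr1.
  by rewrite -vE.
by rewrite fs// -[in '[_, _]](fs _ us) pw scale0r addr0.
Qed.

Lemma orthonormal_exists : infinite_dimensional H ->
  forall n, exists f, orthonormal_upto n f.
Proof.
move=> infH; elim=> [|n [f of_]]; first by exists (fun=> 0).
have [v hv] := infH (mkseq f n).
have /(gram_schmidt_step of_) [w [ow _ _]] : oproj n f v <> v.
  move=> pv; apply: hv; exists (fun i => '[v, f i]).
  rewrite -{1}pv size_mkseq; apply: eq_bigr => i _.
  by rewrite nth_mkseq.
by eexists; exact: ow.
Qed.

End Hilbert.

(** * Bounded operators, the Riesz theorem, rank one operators *)

Section Operators.
Variables (R : realType) (H : hilbert R).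
Local Notation C := R[i].
Local Notation "''[' x , y ]" := (hdot H x y) : ring_scope.
Local Notation hN := (rnorm_is_norm H).
Implicit Types (x y z : H) (a b : bop H).

Lemma bop_ext a b : a =1 b -> a = b.
Proof. by move=> ab; apply: val_inj => /=; apply/funext. Qed.

Lemma fop_ext (a b : fop H) : (a : H -> H) =1 b -> a = b.
Proof. by move=> ab; apply: val_inj; apply: bop_ext. Qed.

Lemma opnorm_has_sup a :
  has_sup [set rnorm (a x) | x in [set x : H | rnorm x <= 1]].
Proof.
split; first by exists (rnorm (a 0)), 0 => //=; rewrite (is_norm0 hN).
have /asboolP[_ [M hM]] := bopP a; exists (cabs M) => _ [x /= x1 <-].
rewrite rnorm_le cabsE (le_trans (hM x))//.
have h0 := le_trans (normr_ge0 _) (hM x).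
rewrite -(ger0_norm h0) normrM normr_id -rnormE -cabsE -rmorphM lecR /=.
by rewrite ler_piMr// cabs_ge0.
Qed.

Lemma opnorm_ge0 a : 0 <= opnorm a.
Proof.
apply: le_trans (rnorm_ge0 (a 0)) _; apply: ub_le_sup.
  by case: (opnorm_has_sup a).
by exists 0 => //=; rewrite (is_norm0 hN).
Qed.

Lemma opnorm_bound a x : rnorm (a x) <= opnorm a * rnorm x.
Proof.
have [->|x0] := eqVneq x 0; first by rewrite linear0 (is_norm0 hN) mulr0.
have px : 0 < rnorm x by rewrite lt_def rnorm_neq0 ?rnorm_ge0.
have iE : cabs ((rnorm x)^-1)%:C%C = (rnorm x)^-1.
  by rewrite cabs_nneg ?invr_ge0 ?rnorm_ge0.
rewrite -ler_pdivrMr// mulrC -[X in X * _]iE -rnormZ -linearZ; apply: ub_le_sup.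
  by case: (opnorm_has_sup a).
by exists (((rnorm x)^-1)%:C%C *: x) => //=; rewrite rnorm_normalize.
Qed.

Lemma opnorm_le a M : 0 <= M -> (forall x, rnorm (a x) <= M * rnorm x) ->
  opnorm a <= M.
Proof.
move=> M0 h; apply: ge_sup; first by case: (opnorm_has_sup a).
by move=> _ [x /= x1 <-]; rewrite (le_trans (h x))// ler_piMr.
Qed.

Lemma bop_of_linear (T : H -> H) M : linear T ->
  (forall x, rnorm (T x) <= M * rnorm x) -> exists t : bop H, t =1 T.
Proof.
move=> lT bT; have tP : T \in bounded_op H.
  apply/asboolP; split=> //; exists M%:C%C => x.
  by rewrite -!rnormE -rmorphM lecR /= bT.
by exists (Bop tP).
Qed.

Lemma bopD a b x : (a + b) x = a x + b x. Proof. by []. Qed.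
Lemma bopZ (c : C) a x : (c *: a) x = c *: a x. Proof. by []. Qed.
Lemma fopD (a b : fop H) x : (a + b) x = a x + b x. Proof. by []. Qed.
Lemma fopZ (c : C) (a : fop H) x : (c *: a) x = c *: a x. Proof. by []. Qed.

Lemma fop_sum (I : Type) (r : seq I) (F : I -> fop H) x :
  (\sum_(i <- r) F i) x = \sum_(i <- r) F i x.
Proof. by apply: (big_morph (fun a : fop H => a x)). Qed.

Lemma bid_subproof : @id H \in bounded_op H.
Proof. by apply/asboolP; split=> [//|]; exists 1 => x; rewrite mul1r. Qed.

Definition bid : bop H := Bop bid_subproof.

Lemma opnorm_bcomp a b : opnorm (bcomp a b) <= opnorm a * opnorm b.
Proof.
apply: opnorm_le => [|x]; first by rewrite mulr_ge0 ?opnorm_ge0.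
rewrite -mulrA (le_trans (opnorm_bound a _))// ler_wpM2l ?opnorm_ge0//.
exact: opnorm_bound.
Qed.

Lemma opnorm_bid : opnorm (bid) <= 1.
Proof. by apply: opnorm_le => // x; rewrite mul1r. Qed.

Lemma ketbra_bounded x y : (fun z => '[z, y] *: x) \in bounded_op H.
Proof.
apply/asboolP; split.
  by move=> c u v; rewrite linearPl /= scalerDl scalerA.
exists ((rnorm y * rnorm x)%:C)%C => z.
rewrite -!rnormE rnormZ -rmorphM lecR /= mulrAC ler_wpM2r ?rnorm_ge0//.
by rewrite mulrC cauchy_schwarz.
Qed.

Lemma ketbra_finite x y : Bop (ketbra_bounded x y) \in @finite_rank R H.
Proof.
apply/asboolP; exists [:: x] => z; exists (fun=> '[z, y]).
by rewrite big_ord1.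
Qed.

Definition ketbra x y : fop H := Fop (ketbra_finite x y).

Lemma ketbraE x y z : ketbra x y z = '[z, y] *: x.
Proof. by []. Qed.

Lemma parallelogram x y :
  rnorm (x + y) ^+ 2 + rnorm (x - y) ^+ 2 = (rnorm x ^+ 2 + rnorm y ^+ 2) *+ 2.
Proof.
apply: complexI; rewrite rmorphMn /= !rmorphD /= !rnorm_sqr dnormD dnormB /=.
by rewrite addrACA subrr addr0 mulr2n.
Qed.

(** The hyperplane [f = 1] has a vector [l] of least norm: minimizing sequences are
   Cauchy by the parallelogram identity. By minimality [l] is orthogonal to the
   kernel of [f], so that [l / ‖l‖²] represents [f]. *)
Lemma riesz (f : H -> C) M :
  (forall c x y, f (c *: x + y) = c * f x + f y) ->
  (forall x, cabs (f x) <= M * rnorm x) -> exists y, forall x, f x = '[x, y].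
Proof.
move=> flin fM.
have [f0|/existsNP[x0 fx0]] := pselect (forall x, f x = 0).
  by exists 0 => x; rewrite f0 linear0r.
move/eqP in fx0.
have f_0 : f 0 = 0.
  by have := flin (-1) 0 0; rewrite scaler0 addr0 mulN1r addNr.
have fZ c x : f (c *: x) = c * f x by rewrite -[c *: x]addr0 flin f_0 addr0.
have fD x y : f (x + y) = f x + f y by rewrite -{1}[x]scale1r flin mul1r.
have fB x y : f (x - y) = f x - f y by rewrite fD -scaleN1r fZ mulN1r.
pose S := [set rnorm x | x in [set x | f x = 1]].
have iS : has_inf S.
  split; first by exists (rnorm ((f x0)^-1 *: x0)), ((f x0)^-1 *: x0); rewrite //= fZ mulVf.
  by exists 0 => _ [x _ <-]; exact: rnorm_ge0.
have dS x : f x = 1 -> inf S <= rnorm x.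
  by move=> fx; apply: ge_inf; [case: iS | exists x].
have d0 : 0 <= inf S.
  by apply: lb_le_inf; [case: iS | move=> _ [x _ <-]; exact: rnorm_ge0].
(* Two almost minimal vectors are close, since their midpoint is in the hyperplane. *)
have close x y (e : R) : 0 <= e -> e <= 1 -> f x = 1 -> f y = 1 ->
    rnorm x <= inf S + e -> rnorm y <= inf S + e ->
    rnorm (x - y) ^+ 2 <= 4%:R * (2 * inf S + 1) * e.
  move=> e0 e1 fx fy hx hy.
  have h1 : inf S *+ 2 <= rnorm (x + y).
    have := dS ((2%:R)^-1 *: (x + y)).
    rewrite fZ fD fx fy mulVf ?pnatr_eq0// => /(_ erefl).
    rewrite rnormZ (_ : cabs _ = 2^-1); last first.
      rewrite /cabs ger0_norm ?invr_ge0 ?ler0n//.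
      by rewrite -(rmorph_nat (real_complex R)) -fmorphV.
    by rewrite mulrC ler_pdivlMr ?ltr0n// mulr_natr.
  have h2 : rnorm (x - y) ^+ 2 =
      (rnorm x ^+ 2 + rnorm y ^+ 2) *+ 2 - rnorm (x + y) ^+ 2.
    by rewrite -parallelogram addrAC subrr add0r.
  have hs z : rnorm z <= inf S + e -> rnorm z ^+ 2 <= (inf S + e) ^+ 2.
    by move=> hz; rewrite ler_pXn2r ?nnegrE ?rnorm_ge0 ?addr_ge0.
  have h3 : (inf S *+ 2) ^+ 2 <= rnorm (x + y) ^+ 2.
    by rewrite ler_pXn2r ?nnegrE ?rnorm_ge0 ?mulrn_wge0.
  have h4 : e ^+ 2 <= e by rewrite expr2 ler_piMr.
  have hx2 := hs _ hx; have hy2 := hs _ hy.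
  rewrite h2; rewrite -mulr_natr !exprMn in h3.
  have := sqrrD (inf S) e; nra.
have /choice [u hu] : forall n : nat, exists x, f x = 1 /\ rnorm x <= inf S + n.+1%:R^-1.
  move=> n; have [_ [x /= fx <-] hx] := @inf_adherent _ S (n.+1%:R^-1) ltac:(by []) iS.
  by exists x; split=> //; exact: ltW.
have [e e0|l hl] := rnorm_complete (f := u).
  pose d := e ^+ 2 / (4%:R * (2 * inf S + 1)).
  have c0 : 0 < 4%:R * (2 * inf S + 1) by rewrite mulr_gt0// ltr_wpDl ?mulr_ge0.
  have dd0 : 0 < d by rewrite divr_gt0// exprn_gt0.
  have [n hn] := invS_small dd0; exists n => m k nm nk.
  rewrite -(@ltr_pXn2r _ 2)// ?nnegrE ?rnorm_ge0 ?(ltW e0)//.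
  have [fm hm] := hu m; have [fk hk] := hu k.
  have hi j : (n <= j)%N -> inf S + j.+1%:R^-1 <= inf S + n.+1%:R^-1.
    by move=> nj; rewrite lerD2l lef_pV2 ?posrE// ler_nat ltnS.
  have n1 : n.+1%:R^-1 <= 1 :> R by rewrite invf_le1// ler1n.
  have nn0 : 0 <= n.+1%:R^-1 :> R by rewrite invr_ge0.
  apply: le_lt_trans (close _ _ _ nn0 n1 fm fk (le_trans hm (hi _ nm)) (le_trans hk (hi _ nk))) _.
  by rewrite mulrC -ltr_pdivlMr//; apply: hn.
have fl : f l = 1.
  apply/eqP; rewrite -subr_eq0 -normr_eq0 -cabsE.
  suff : cabs (f l - 1) <= 0 by rewrite le_eqVlt ltNge cabs_ge0 orbF => /eqP ->.
  apply/ler_addgt0Pl => e e0; rewrite addr0.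
  have [d dd0 hd] := small_factor M e0.
  have [n hn] := hl _ dd0; have [fn _] := hu n.
  rewrite -fn -fB (le_trans (fM _))// (le_trans _ hd)//.
  have M0 : 0 <= M.
    have nx0 : rnorm (u n) != 0.
      apply/eqP => /(is_norm_eq0 hN) un0; move: fn; rewrite un0 f_0 => /eqP.
      by rewrite eq_sym oner_eq0.
    have := le_trans (cabs_ge0 _) (fM (u n)).
    by rewrite pmulr_lge0// lt_def nx0 rnorm_ge0.
  by rewrite ler_wpM2l// (is_normB hN) ltW// hn.
have ld : rnorm l <= inf S.
  apply/ler_addgt0Pl => e e0.
  have e20 : 0 < e / 2%:R by rewrite divr_gt0.
  have [n hn] := hl _ e20; have [n' hn'] := invS_small e20.
  set k := maxn n n'; have [_ hk] := hu k.
  have h1 := hn k (leq_maxl _ _); have h2 := hn' k (leq_maxr _ _).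
  have h3 := is_norm_leD hN l (u k); rewrite (is_normB hN) /= in h3.
  have arith (p q r s v : R) : p <= q + r -> q <= s + v -> r < e / 2%:R ->
      v < e / 2%:R -> p <= e + s by lra.
  exact: arith h3 hk h1 h2.
have orth z : f z = 0 -> '[z, l] = 0.
  (* Otherwise [l + t *: z], the component of [l] orthogonal to [z], would be shorter. *)
  move=> fz; have [->|z0] := eqVneq z 0; first by rewrite linear0l.
  have zz : '[z, z] != 0 by rewrite dnorm_eq0.
  pose t := - ('[l, z] / '[z, z]).
  have ou : '[l + t *: z, t *: z] = 0.
    by rewrite linearZr_LR /= linearDl /= linearZl_LR /= mulNr divfK// subrr mulr0.
  have h1 : rnorm l <= rnorm (l + t *: z).
    by apply: le_trans ld (dS _ _); rewrite fD fZ fz mulr0 addr0.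
  have h2 : '[l, l] = '[l + t *: z, l + t *: z] + '[t *: z, t *: z].
    by rewrite -(hnormBd ou) addrK.
  have h3 : '[l, l] <= '[l + t *: z, l + t *: z].
    by rewrite -!rnorm_sqr lecR ler_pXn2r ?nnegrE ?rnorm_ge0.
  have h4 : '[t *: z, t *: z] <= 0 by move: h3; rewrite h2 gerDl.
  have : '[t *: z, t *: z] == 0 by rewrite eq_le h4 dnorm_ge0.
  rewrite dnorm_eq0 scaler_eq0 (negbTE z0) orbF.
  rewrite oppr_eq0 mulf_eq0 invr_eq0 (negbTE zz) orbF => /eqP.
  exact: dot_eq0C.
have ll : '[l, l] != 0.
  rewrite dnorm_eq0; apply/eqP => l0; move: fl; rewrite l0 f_0 => /eqP.
  by rewrite eq_sym oner_eq0.
exists (('[l, l])^-1 *: l) => y.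
have := orth (y - f y *: l); rewrite fB fZ fl mulr1 subrr => /(_ erefl).
rewrite linearBl /= linearZl_LR /= => /eqP; rewrite subr_eq0 => /eqP yl.
by rewrite linearZr_LR /= geC0_conj ?invr_ge0 ?dnorm_ge0// yl mulrCA mulVf// mulr1.
Qed.

(** The coordinates of [a x] in an orthonormal system spanning the range of [a] are
   bounded functionals of [x], to which the Riesz theorem applies. *)
Lemma fop_ketbra (a : fop H) :
  exists s : seq (H * H), a = \sum_(p <- s) ketbra p.1 p.2.
Proof.
have /asboolP[s hs] := fopP a.
have [n [f [of_ fs]]] := gram_schmidt s.
have ha x : oproj n f (a x) = a x.
  have [c ->] := hs x.
  rewrite (lin_sum (@oproj_linear _ _ n f)); apply: eq_bigr => j _.
  by rewrite (linZ (@oproj_linear _ _ n f)) fs// mem_nth.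
have /choice [g hg] : forall i, exists y, forall x, '[a x, f i] = '[x, y].
  move=> i; apply: (@riesz _ (opnorm a * rnorm (f i))) => [c x y|x].
    by rewrite linearP linearPl.
  rewrite (le_trans (cauchy_schwarz _ _))// mulrAC ler_wpM2r ?rnorm_ge0//.
  exact: opnorm_bound.
exists [seq (f i, g i) | i <- index_iota 0 n]; apply: fop_ext => x.
rewrite big_map fop_sum big_mkord -[LHS]ha; apply: eq_bigr => i _ /=.
by rewrite hg.
Qed.

End Operators.

(** * Operators prescribed on a total family *)

Section Total.
Variables (R : realType) (H : hilbert R).
Local Notation C := R[i].
Local Notation hN := (rnorm_is_norm H).

Definition comb (I : Type) (k : I -> H) (s : seq (C * I)) : H :=
  \sum_(p <- s) p.1 *: k p.2.

Definition in_closed_span (I : Type) (k : I -> H) (h : H) :=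
  forall eps : R, 0 < eps -> exists s, rnorm (comb k s - h) < eps.

Definition total_family (I : Type) (k : I -> H) := forall h, in_closed_span k h.

Lemma combZD (I : Type) (k : I -> H) c s t :
  comb k ([seq (c * p.1, p.2) | p <- s] ++ t) = c *: comb k s + comb k t.
Proof.
rewrite /comb big_cat big_map /= scaler_sumr; congr (_ + _).
by apply: eq_bigr => p _; rewrite scalerA.
Qed.

Lemma comb_linear (W : lmodType C) (T : H -> W) (I : Type) (k : I -> H) s : linear T ->
  T (comb k s) = \sum_(p <- s) p.1 *: T (k p.2).
Proof.
by move=> lT; rewrite /comb (lin_sum lT); apply: eq_bigr => p _; rewrite (linZ lT).
Qed.

Lemma in_closed_span_comb (I J : Type) (k : I -> H) (l : J -> H) s :
  (forall i, in_closed_span l (k i)) -> in_closed_span l (comb k s).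
Proof.
move=> kl; elim: s => [|[c i] s IH] e e0.
  by exists [::]; rewrite /comb !big_nil subrr (is_norm0 hN).
have [d d0 hd] := small_factor (cabs c + 1) e0.
have [t ht] := kl i _ d0; have [t' ht'] := IH _ d0.
exists ([seq (c * p.1, p.2) | p <- t] ++ t'); rewrite combZD.
have -> : comb k ((c, i) :: s) = c *: k i + comb k s by rewrite /comb big_cons.
rewrite opprD addrACA -scalerBr.
apply: le_lt_trans (is_normD hN _ _) _; rewrite /= rnormZ (lt_le_trans _ hd)//.
by rewrite mulrDl mul1r ler_ltD// ler_wpM2l ?cabs_ge0// ltW.
Qed.

Lemma total_trans (I J : Type) (k : I -> H) (l : J -> H) :
  total_family k -> (forall i, in_closed_span l (k i)) -> total_family l.
Proof.
move=> tk kl h e e0.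
have e20 : 0 < e / 2%:R by rewrite divr_gt0.
have [s hs] := tk h _ e20.
have [t ht] := in_closed_span_comb s kl e20.
exists t; apply: le_lt_trans (is_norm_tri hN _ (comb k s) _) _.
by rewrite [e]splitr ltrD.
Qed.

Lemma bop_total_eq (I : Type) (k : I -> H) (S T : bop H) :
  total_family k -> (forall i, S (k i) = T (k i)) -> S = T.
Proof.
move=> tk ST; apply: bop_ext.
apply: (@dense_eq _ _ _ _ _ (range (comb k)) _ _ _ _ hN hN) => //.
- exact: bop_linear.
- exact: bop_linear.
- exact: opnorm_bound.
- exact: opnorm_bound.
- by move=> x e e0; have [s hs] := tk x _ e0; exists (comb k s) => //; exists s.
- move=> _ [s _ <-]; rewrite !comb_linear; [|exact: bop_linear|exact: bop_linear].
  by apply: eq_bigr => p _; rewrite ST.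
Qed.

Lemma bop_of_family (I : Type) (k l : I -> H) M : total_family k ->
  (forall s, rnorm (comb l s) <= M * rnorm (comb k s)) ->
  exists T : bop H,
    (forall i, T (k i) = l i) /\ (forall x, rnorm (T x) <= M * rnorm x).
Proof.
move=> tk hb.
have [|||T [lT GT bT]] := @bounded_extension R H H _ _ hN hN (@rnorm_complete _ H)
  (fun x y => exists s, x = comb k s /\ y = comb l s) M.
- move=> c _ _ _ _ [s [-> ->]] [t [-> ->]].
  by exists ([seq (c * p.1, p.2) | p <- s] ++ t); rewrite !combZD.
- by move=> _ _ [s [-> ->]]; exact: hb.
- move=> x e e0; have [s hs] := tk x _ e0.
  by exists (comb k s), (comb l s); split=> //; exists s.
have [t ht] := bop_of_linear lT bT.
exists t; split=> [i|x]; rewrite ht; last exact: bT.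
by apply: GT; exists [:: (1, i)]; rewrite /comb !big_seq1 !scale1r.
Qed.

End Total.

(** * Tensor products of bounded operators *)

Section TensorSquare.
Variables (R : realType) (L H : hilbert R) (B : L -> L -> H).
Local Notation C := R[i].

(** Satisfied both by the given tensor square and by its transport to [L] along the
   unitary isomorphism, so that operators are constructed once for both. *)
Record is_tensor_square : Prop := IsTensorSquare {
  ts_bilinear : is_bilinear B;
  ts_dot : forall x y x' y',
    hdot H (B x y) (B x' y') = hdot L x x' * hdot L y y';
  ts_total : total_family (fun p : L * L => B p.1 p.2) }.

End TensorSquare.

Section TensorSquareFlip.
Variables (R : realType) (L H : hilbert R) (B : L -> L -> H).
Local Notation C := R[i].
Hypothesis hB : is_tensor_square B.

Lemma ts_flip : is_tensor_square (fun x y => B y x).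
Proof.
case: hB => [[bl br] bd bt]; split; first by split.
- by move=> *; rewrite bd mulrC.
- move=> h e e0; have [s hs] := bt h _ e0.
  exists [seq (p.1, (p.2.2, p.2.1)) | p <- s].
  by rewrite /comb big_map.
Qed.

Lemma ts_norm x y : rnorm (B x y) = rnorm x * rnorm y.
Proof.
apply/eqP; rewrite -(@eqrXn2 _ 2)// ?mulr_ge0 ?rnorm_ge0//; apply/eqP.
apply: complexI; rewrite exprMn.
by rewrite [RHS]rmorphM /= !rnorm_sqr (ts_dot hB).
Qed.

End TensorSquareFlip.

Section TensorSquareOp.
Variables (R : realType) (L H : hilbert R).
Local Notation C := R[i].
Local Notation tens_comb B := (comb (fun p : L * L => B p.1 p.2)).

(** The operator [a ⊗ 1]. Once the second factors are expanded in an orthonormal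
   system [f], a tensor is [∑ z_i ⊗ f_i], its squared norm is [∑ ‖z_i‖²], and each
   [‖a z_i‖] is at most [‖a‖ ‖z_i‖]. *)
Lemma ts_bound_l (B : L -> L -> H) (hB : is_tensor_square B) (a : bop L) s :
  rnorm (tens_comb (fun x y => B (a x) y) s) <= opnorm a * rnorm (tens_comb B s).
Proof.
have [n [f [of_ fs]]] := gram_schmidt [seq p.2.2 | p <- s].
have [bl br] := ts_bilinear hB.
have E (T : L -> L) : linear T -> tens_comb (fun x y => B (T x) y) s =
    \sum_(i < n) B (T (\sum_(p <- s) (p.1 * hdot L p.2.2 (f i)) *: p.2.1)) (f i).
  move=> lT; rewrite /comb.
  under [RHS]eq_bigr => i _.
    rewrite (lin_sum lT) (lin_sum (bl (f i))).
    under eq_bigr => p _ do rewrite (linZ lT) (linZ (bl (f i))) mulrC -scalerA.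
    over.
  rewrite exchange_big /=; apply: eq_big_seq => p ps.
  have {1}<- : oproj n f p.2.2 = p.2.2 by apply: fs; apply: map_f.
  rewrite (lin_sum (br _)) scaler_sumr; apply: eq_bigr => i _.
  by rewrite (linZ (br _)) !scalerA mulrC.
have N (z : nat -> L) :
    rnorm (\sum_(i < n) B (z i) (f i)) ^+ 2 = \sum_(i < n) rnorm (z i) ^+ 2.
  apply: complexI; rewrite rnorm_sqr.
  rewrite linear_sumlz rmorph_sum; apply: eq_bigr => i _.
  rewrite linear_sumr (bigD1 i) //= big1 => [|j ji].
    by rewrite (ts_dot hB) of_// eqxx mulr1 addr0 rnorm_sqr.
  by rewrite (ts_dot hB) of_// eq_sym (negbTE (_ : val j != val i)) ?mulr0.
rewrite (E a (bop_linear a)) (E idfun (fun _ _ _ => erefl)).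
set z := fun i : nat => \sum_(p <- s) (p.1 * hdot L p.2.2 (f i)) *: p.2.1.
rewrite -(@ler_pXn2r _ 2)// ?nnegrE ?mulr_ge0 ?opnorm_ge0 ?rnorm_ge0//.
rewrite exprMn (N (fun i => a (z i))) (N z) mulr_sumr ler_sum// => i _.
rewrite -exprMn ler_pXn2r ?nnegrE ?mulr_ge0 ?opnorm_ge0 ?rnorm_ge0//.
exact: opnorm_bound.
Qed.

(** [a ⊗ b] is the composite of [a ⊗ 1] and, after exchanging the factors, [1 ⊗ b]. *)
Lemma ts_bound (B : L -> L -> H) (hB : is_tensor_square B) (a b : bop L) s :
  rnorm (tens_comb (fun x y => B (a x) (b y)) s)
  <= opnorm a * opnorm b * rnorm (tens_comb B s).
Proof.
have := ts_bound_l hB a [seq (p.1, (p.2.1, b p.2.2)) | p <- s].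
have := ts_bound_l (ts_flip hB) b [seq (p.1, (p.2.2, p.2.1)) | p <- s].
rewrite /comb !big_map /= => hb ha; rewrite (le_trans ha)// -mulrA.
by rewrite ler_wpM2l ?opnorm_ge0.
Qed.

Lemma ts_op (B : L -> L -> H) (hB : is_tensor_square B) (a b : bop L) :
  exists T : bop H, (forall x y, T (B x y) = B (a x) (b y)) /\
    (forall h, rnorm (T h) <= opnorm a * opnorm b * rnorm h).
Proof.
have [T [TB bT]] := bop_of_family (ts_total hB) (ts_bound hB a b).
by exists T; split=> // x y; have /= := TB (x, y).
Qed.

Lemma ts_op_eq (B : L -> L -> H) (hB : is_tensor_square B) (S T : bop H) :
  (forall x y, S (B x y) = T (B x y)) -> S = T.
Proof. by move=> ST; apply: (bop_total_eq (ts_total hB)) => -[]. Qed.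

End TensorSquareOp.

(** * The operation ♦ on operators of L *)

Section Diamond.
Variables (R : realType) (L : hilbert R) (Hs : hilbert_square L) (iota : unitary Hs L).
Local Notation C := R[i].

Implicit Types a b : bop L.

Lemma htens_tensor_square : is_tensor_square (htens Hs).
Proof.
split; [exact: htens_bilinear|exact: htens_dot|].
move=> h e e0.
have ec : 0 < e%:C%C by rewrite (ltcR 0).
have [||y [/= hy [s yE]]] := @htens_dense _ _ Hs (ball h e%:C%C).
- by exists h; exact: ballxx.
- exact: ball_open.
exists [seq (1, p) | p <- s]; rewrite /comb big_map /=.
under eq_bigr do rewrite scale1r.
by move: hy; rewrite yE -ball_normE /= -rnormE ltcR (is_normB (rnorm_is_norm Hs)).
Qed.

Lemma uni_rnorm h : rnorm (iota h) = rnorm h.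
Proof. by rewrite /rnorm uni_norm. Qed.

(** The product of vectors on which [a ♦ b] acts factor by factor. *)
Definition vdiamond (x y : L) : L := iota (htens Hs x y).

Lemma vdiamond_tensor_square : is_tensor_square vdiamond.
Proof.
have [[bl br] bd bt] := htens_tensor_square.
split.
- split=> [w c x y|v c x y]; rewrite /vdiamond; first by rewrite bl uni_linear.
  by rewrite br uni_linear.
- by move=> *; rewrite uni_dot bd.
- move=> h e e0; have [s hs] := bt (uni_inv iota h) _ e0; exists s.
  have -> : comb (fun p => iota (htens Hs p.1 p.2)) s =
      iota (comb (fun p => htens Hs p.1 p.2) s).
    by rewrite (comb_linear _ _ (@uni_linear _ _ _ iota)).
  by rewrite -[X in _ - X](uni_invK iota) -(linB (@uni_linear _ _ _ iota)) uni_rnorm.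
Qed.

Local Notation vd := vdiamond.
Local Notation vdP := vdiamond_tensor_square.

Lemma diamondE a b x y : diamond iota a b (vd x y) = vd (a x) (b y).
Proof.
rewrite /diamond /unitary_conj /= /vd uniK /htens_op.
case: xgetP => [T _ /= -> //|none].
by have [T [hT _]] := ts_op htens_tensor_square a b; case: (none T).
Qed.

Lemma diamond_eq a b (T : bop L) :
  (forall x y, T (vd x y) = vd (a x) (b y)) -> diamond iota a b = T.
Proof. by move=> hT; apply: (ts_op_eq vdP) => x y; rewrite hT diamondE. Qed.

Lemma opnorm_diamond a b : opnorm (diamond iota a b) <= opnorm a * opnorm b.
Proof.
have [T [hT bT]] := ts_op vdP a b; rewrite (diamond_eq hT).
by apply: opnorm_le bT; rewrite mulr_ge0 ?opnorm_ge0.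
Qed.

Lemma diamond_bilinear : is_bilinear (diamond iota).
Proof.
have [bl br] := ts_bilinear vdP.
split=> [b c a a'|a c b b'] /=; apply: diamond_eq => x y.
  by rewrite bopD bopZ !diamondE bl.
by rewrite bopD bopZ !diamondE br.
Qed.

Lemma diamond_comp a b a' b' :
  diamond iota (bcomp a a') (bcomp b b') =
  bcomp (diamond iota a b) (diamond iota a' b').
Proof.
apply: diamond_eq => x y.
by rewrite -[LHS]/(diamond iota a b (diamond iota a' b' (vd x y))) !diamondE.
Qed.

Lemma diamond_ketbra x y x' y' :
  diamond iota (ketbra x y) (ketbra x' y') = ketbra (vd x x') (vd y y').
Proof.
have [bl br] := ts_bilinear vdP.
apply: diamond_eq => z z'; rewrite !ketbraE (ts_dot vdP).
by rewrite (linZ (bl _)) (linZ (br _)) scalerA.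
Qed.

Lemma fop_bop_linear : linear (@fop_bop R L).
Proof. by []. Qed.

(** [a] and [b] are sums of rank one operators, and ♦ preserves rank one. *)
Lemma diamond_finite_rank (a b : fop L) : diamond iota a b \in @finite_rank R L.
Proof.
have [bl br] := diamond_bilinear.
have [s ->] := fop_ketbra a; have [t ->] := fop_ketbra b.
rewrite !(lin_sum fop_bop_linear) (lin_sum (bl _)) rpred_sum// => p _.
rewrite (lin_sum (br _)) rpred_sum// => q _.
by rewrite diamond_ketbra fopP.
Qed.

Lemma fdiamondE (a b : fop L) : fdiamond iota a b = diamond iota a b :> bop L.
Proof. exact: (insubdK _ (diamond_finite_rank a b)). Qed.

Lemma fdiamond_ketbra x y x' y' :
  fdiamond iota (ketbra x y) (ketbra x' y') = ketbra (vd x x') (vd y y').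
Proof. by apply: val_inj; rewrite /= fdiamondE diamond_ketbra. Qed.

Lemma fdiamond_bilinear : is_bilinear (fdiamond iota).
Proof.
have [bl br] := diamond_bilinear.
split=> [b c a a'|a c b b']; apply: val_inj; rewrite /= fdiamondE fop_bop_linear !fdiamondE.
  exact: bl.
exact: br.
Qed.

(** [V] sends [x ♦ (y ♦ z)] to [(x ♦ y) ♦ z] and [W] is its inverse: both are
   isometric on the linear combinations of such vectors because the two families
   have the same inner products, and both families are total. *)
Lemma diamond_assoc : exists V W : bop L, [/\ opnorm V <= 1, opnorm W <= 1 &
  forall a b c : bop L,
    bcomp W (bcomp (diamond iota (diamond iota a b) c) V) =
    diamond iota a (diamond iota b c)].
Proof.
pose k (p : L * (L * L)) := vd p.1 (vd p.2.1 p.2.2).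
pose l (p : L * (L * L)) := vd (vd p.1 p.2.1) p.2.2.
have [bl br] := ts_bilinear vdP.
have tk : total_family k.
  apply: total_trans (ts_total vdP) _ => -[x w] /= e e0.
  have [d d0 hd] := small_factor (rnorm x + 1) e0.
  have [s hs] := ts_total vdP w d0.
  exists [seq (p.1, (x, p.2)) | p <- s].
  have -> : comb k [seq (p.1, (x, p.2)) | p <- s] = vd x (comb (fun p => vd p.1 p.2) s).
    by rewrite (comb_linear _ _ (br x)) /comb big_map.
  rewrite -(linB (br x)) (ts_norm vdP).
  apply: lt_le_trans hd; rewrite mulrDl mul1r.
  by apply: le_lt_trans (ler_wpM2l (rnorm_ge0 x) (ltW hs)) _; rewrite ltrDl.
have tl : total_family l.
  apply: total_trans (ts_total vdP) _ => -[w x] /= e e0.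
  have [d d0 hd] := small_factor (rnorm x + 1) e0.
  have [s hs] := ts_total vdP w d0.
  exists [seq (p.1, (p.2.1, (p.2.2, x))) | p <- s].
  have -> : comb l [seq (p.1, (p.2.1, (p.2.2, x))) | p <- s] =
      vd (comb (fun p => vd p.1 p.2) s) x.
    by rewrite (comb_linear _ _ (bl x)) /comb big_map.
  rewrite -(linB (bl x)) (ts_norm vdP).
  apply: lt_le_trans hd; rewrite mulrDl mul1r mulrC.
  by apply: le_lt_trans (ler_wpM2l (rnorm_ge0 x) (ltW hs)) _; rewrite ltrDl.
have kl s : rnorm (comb k s) = rnorm (comb l s).
  apply: rnorm_eq_dot; rewrite /comb !linear_sumlz; apply: eq_bigr => p _.
  rewrite !linear_sumr; apply: eq_bigr => q _.
  by rewrite !linearZl_LR !linearZr_LR /= /k /l !(ts_dot vdP) mulrA.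
have [|V [hV bV]] := @bop_of_family _ _ _ k l 1 tk; first by move=> s; rewrite mul1r kl.
have [|W [hW bW]] := @bop_of_family _ _ _ l k 1 tl; first by move=> s; rewrite mul1r kl.
exists V, W; split; [exact: opnorm_le|exact: opnorm_le|move=> a b c].
apply: (bop_total_eq tk) => -[x [y z]].
rewrite -[LHS]/(W (diamond iota (diamond iota a b) c (V (k (x, (y, z)))))) hV.
rewrite /l /k !diamondE.
exact: (hW (a x, (b y, c z))).
Qed.

(** [a] is a corner of [p ♦ a], where [p] projects on the unit vector [z]: take
   [S x = z ♦ x] and [T (x ♦ y) = <x, z> y]. The latter is bounded because
   [z ♦ T h = (p ♦ 1) h]. *)
Lemma diamond_corner (z : L) : rnorm z = 1 -> exists S T : bop L,
  forall a : bop L, bcomp T (bcomp (diamond iota (ketbra z z) a) S) = a.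
Proof.
move=> z1; have [bl br] := ts_bilinear vdP.
have zz := dot_unit z1.
have [|S hS] := @bop_of_linear _ _ (vd z) 1 (br z).
  by move=> x; rewrite (ts_norm vdP) z1.
have [|T [hT _]] := @bop_of_family _ _ _ (fun p : L * L => vd p.1 p.2)
    (fun p => hdot L p.1 z *: p.2) (opnorm (ketbra z z) * opnorm (bid L)) (ts_total vdP).
  move=> s; rewrite (le_trans _ (ts_bound vdP _ _ s))//.
  rewrite /comb -[X in X <= _]mul1r -z1 -(ts_norm vdP) (lin_sum (br z)).
  rewrite le_eqVlt; apply/orP; left; apply/eqP; congr rnorm; apply: eq_bigr => p _.
  by rewrite ketbraE (linZ (br z)) (linZ (br z)) (linZ (bl _)).
exists S, T => a; apply: bop_ext => x.
rewrite -[LHS]/(T (diamond iota (ketbra z z) a (S x))) hS diamondE ketbraE zz scale1r.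
by rewrite (hT (z, a x)) /= zz scale1r.
Qed.

End Diamond.

(** * Amplifications: bimodule structure and supports *)

Section TensFacts.
Variables (K : comNzRingType) (V W : lmodType K).

Lemma tens_ind (P : tens V W -> Prop) :
  (forall v w, P (v ⊗ w)) -> (forall x y, P x -> P y -> P (x + y)) ->
  forall x, P x.
Proof.
move=> Pp PD x; rewrite (tens_sum x); elim/big_ind: _ => //.
by rewrite -(lin0 ((pure_bilinear V W).1 0)).
Qed.

End TensFacts.

Section Amplification.
Variables (R : realType) (L : hilbert R).
Local Notation C := R[i].
Local Notation ampl := (ampl L).

Lemma fcompl_linear (a : bop L) : linear (fcompl a).
Proof. by move=> c b b'; apply: fop_ext => x /=; rewrite linearP. Qed.

Lemma fcompr_linear (a : bop L) : linear (fun b : fop L => fcompr b a).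
Proof. by move=> c b b'; apply: fop_ext. Qed.

Section OneSpace.
Variable E : lmodType C.
Implicit Types (u v : ampl E) (a b : bop L) (c : fop L) (x : E).

Lemma id_linear : linear (@id E). Proof. by []. Qed.

Lemma lactE a c x : lact a (c ⊗ x) = fcompl a c ⊗ x.
Proof. exact/tens_mapE/id_linear/fcompl_linear. Qed.

Lemma ractE a c x : ract (c ⊗ x) a = fcompr c a ⊗ x.
Proof. exact/tens_mapE/id_linear/fcompr_linear. Qed.

Lemma lact_linear a : linear (@lact R L E a).
Proof. exact/tens_map_linear/id_linear/fcompl_linear. Qed.

Lemma ract_linear a : linear (fun u => @ract R L E u a).
Proof. exact/tens_map_linear/id_linear/fcompr_linear. Qed.

Definition biact a u b : ampl E := ract (lact a u) b.

Lemma biact_linear a b : linear (fun u => biact a u b).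
Proof. by move=> k u v; rewrite /biact lact_linear ract_linear. Qed.

Lemma biactE a b c x : biact a (c ⊗ x) b = fcompr (fcompl a c) b ⊗ x.
Proof. by rewrite /biact lactE ractE. Qed.

(** The operators in [u] are sums of operators [ketbra x y]; it is enough that the
   self-adjoint [P] fixes the finitely many vectors [x] and [y] which occur. *)
Lemma biact_oproj u : exists s : seq L, forall P : fop L,
  (forall y z : L, hdot L (P y) z = hdot L y (P z)) ->
  (forall z, z \in s -> P z = z) -> biact P u P = u.
Proof.
elim/tens_ind: u => [c x|u v [s hs] [t ht]].
  have [t ht] := fop_ketbra c.
  exists (map fst t ++ map snd t) => P symP fixP.
  rewrite biactE; congr (_ ⊗ x); apply: fop_ext => z.
  rewrite -[LHS]/(P (c (P z))) ht !fop_sum linear_sum; apply: eq_big_seq => p pt.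
  rewrite !ketbraE linearZ /= symP !fixP// mem_cat map_f ?orbT//.
exists (s ++ t) => P symP fixP.
rewrite (linD (biact_linear _ _)) hs ?ht// => w hw; apply: fixP.
  by rewrite mem_cat hw orbT.
by rewrite mem_cat hw.
Qed.

Lemma biact_support u : exists P : fop L, opnorm P <= 1 /\ biact P u P = u.
Proof.
have [s hs] := biact_oproj u; have [n [f [of_ fs]]] := gram_schmidt s.
pose P : fop L := \sum_(i < n) ketbra (f i) (f i).
have PE (y : L) : P y = oproj n f y by rewrite fop_sum.
exists P; split.
  by apply: opnorm_le => // x; rewrite PE mul1r oproj_contract.
apply: hs => [x y|v vs]; first by rewrite !PE oproj_sym.
by rewrite PE fs.
Qed.

End OneSpace.

Section Map.
Variables (E F : lmodType C) (phi : E -> F).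
Hypothesis lphi : linear phi.

Lemma ampl_mapE c x : ampl_map phi (c ⊗ x) = c ⊗ phi x :> ampl F.
Proof. exact: (tens_mapE (id_linear (E := fop L))). Qed.

Lemma ampl_map_biact a u b : ampl_map phi (biact a u b) = biact a (ampl_map phi u) b.
Proof.
have lp := @ampl_map_linear R L _ _ _ lphi.
elim/tens_ind: u => [c x|u v hu hv]; first by rewrite !(biactE, ampl_mapE).
by rewrite (linD (biact_linear _ _)) !(linD lp) (linD (biact_linear _ _)) hu hv.
Qed.

End Map.

Section Bil.
Variables (Hs : hilbert_square L) (iota : unitary Hs L).
Variables (E F G : lmodType C) (B : E -> F -> G).
Hypothesis hB : is_bilinear B.

Let inner_bilinear (a : fop L) (x : E) :
  is_bilinear (fun b y => fdiamond iota a b ⊗ B x y).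
Proof.
have [pl pr] := pure_bilinear (fop L) G; have [dl dr] := fdiamond_bilinear iota.
split=> [y c b b'|b c y y'] /=; first by rewrite dr pl.
by rewrite hB.2 pr.
Qed.

Let outer_bilinear (v : ampl F) :
  is_bilinear (fun a x => tlift (fun b y => fdiamond iota a b ⊗ B x y) v).
Proof.
have [pl pr] := pure_bilinear (fop L) G; have [dl dr] := fdiamond_bilinear iota.
split=> [x c a a'|a c x x'] /=; elim/tens_ind: v => [b y|v w hv hw].
- by rewrite !tliftE// dl pl.
- rewrite !(linD (tlift_linear (inner_bilinear _ _))) hv hw scalerDr.
  by rewrite addrACA.
- by rewrite !tliftE// hB.1 pr.
- rewrite !(linD (tlift_linear (inner_bilinear _ _))) hv hw scalerDr.
  by rewrite addrACA.
Qed.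

Lemma ampl_bilE a x b y :
  ampl_bil iota B (a ⊗ x) (b ⊗ y) = fdiamond iota a b ⊗ B x y.
Proof. by rewrite /ampl_bil !tliftE. Qed.

Lemma ampl_bil_bilinear : is_bilinear (ampl_bil iota B).
Proof.
split=> [v|u c v w]; first exact: tlift_linear.
elim/tens_ind: u => [a x|u u' hu hu'].
  by rewrite /ampl_bil !tliftE// tlift_linear.
have D v' := linD (tlift_linear (outer_bilinear v')).
by rewrite /ampl_bil !D -!/(ampl_bil _ _ _ _) hu hu' scalerDr addrACA.
Qed.

End Bil.
End Amplification.

(** * Q-spaces and their underlying norm *)

Section RankOne.
Variables (R : realType) (L : hilbert R).
Local Notation C := R[i].

Lemma ketbra_projection (z : L) : rnorm z = 1 -> rank_one_projection (ketbra z z).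
Proof.
move=> z1; have zz := dot_unit z1.
have z0 : z != 0 by rewrite -(dnorm_eq0 (hdot L)) zz oner_eq0.
split; first split=> [x|x y].
- by rewrite !ketbraE linearZl_LR /= zz mulr1.
- by rewrite !ketbraE linearZl_LR linearZr_LR /= (dotC z y) mulrC.
exists z => //; apply/seteqP; split=> _ [c _ <-]; first by exists (hdot L c z).
by exists (c *: z) => //; rewrite ketbraE linearZl_LR /= zz mulr1.
Qed.

Lemma rank_one_ketbra (p : fop L) : rank_one_projection p ->
  exists z, rnorm z = 1 /\ p = ketbra z z.
Proof.
move=> [[pp symp] [v v0 pv]].
have nv : rnorm v != 0 by exact: rnorm_neq0.
have vE : p v = v.
  have : range p v by rewrite pv; exists 1 => //; rewrite scale1r.
  by case=> x _ <-; rewrite pp.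
pose z := ((rnorm v)^-1)%:C%C *: v.
have z1 : rnorm z = 1 by exact: rnorm_normalize.
have zz := dot_unit z1.
exists z; split=> //; apply: fop_ext => x; rewrite ketbraE.
have [c _ cx] : range (fun c : C => c *: v) (p x) by rewrite -pv; exists x.
have pz : p z = z by rewrite linearZ /= vE.
have vz : v = (rnorm v)%:C%C *: z.
  by rewrite scalerA -rmorphM /= divff// scale1r.
have := symp x z; rewrite pz -cx vz scalerA linearZl_LR /= zz mulr1 => ->.
by [].
Qed.

(** Any rank one operator is a two-sided multiple of any rank one projection, which
   makes the norms [x |-> ‖a x‖], for [a] of rank one, comparable to each other. *)
Lemma ketbra_factor (x y z : L) : rnorm z = 1 ->
  ketbra x y = fcompr (fcompl (ketbra x z) (ketbra z z)) (ketbra z y).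
Proof.
move=> z1; have zz := dot_unit z1.
apply: fop_ext => w.
rewrite -[RHS]/(ketbra x z (ketbra z z (ketbra z y w))) !ketbraE.
by do 2! rewrite linearZl_LR /= zz mulr1.
Qed.

End RankOne.

Section QSpaceFacts.
Variables (R : realType) (L : hilbert R).
Local Notation C := R[i].
Local Notation ampl := (ampl L).
Local Notation qspace := (qspace L).

Lemma qnorm_is_norm (E : qspace) : is_norm (@qnorm R L E).
Proof.
have h := qnormP E; split; [exact: qnormD h|exact: qnormZ h|exact: qnorm_eq0 h].
Qed.

Lemma qnorm_biact (E : qspace) (a b : bop L) (u : ampl E) :
  qnorm (biact a u b) <= opnorm a * qnorm u * opnorm b.
Proof. exact: qnorm_bimod (qnormP E) _ _ _. Qed.

Hypothesis infL : infinite_dimensional L.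

(** A single [z] serves all Q-spaces: the projection in the definition of the
   underlying norm is chosen independently of the space. *)
Lemma unormE : exists z : L, rnorm z = 1 /\
  forall (E : qspace) (x : E), unorm x = qnorm (ketbra z z ⊗ x : ampl E).
Proof.
have [f of_] := orthonormal_exists infL 1.
have f1 : rnorm (f 0%N) = 1.
  apply/eqP; rewrite -(@eqrXn2 _ 2)// ?rnorm_ge0// expr1n; apply/eqP.
  by apply: complexI; rewrite rnorm_sqr of_.
rewrite /unorm; case: xgetP => [p _ /rank_one_ketbra[z [z1 ->]]|none].
  by exists z.
by case: (none _ (ketbra_projection f1)).
Qed.

Lemma unorm_is_norm (E : qspace) : is_norm (@unorm R L E).
Proof.
have [z [z1 uE]] := unormE; have [pl pr] := pure_bilinear (fop L) E.
have hq := qnorm_is_norm E.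
split=> [x y|c x|x].
- by rewrite !uE (linD (pr _)) (is_normD hq).
- by rewrite !uE (linZ (pr _)) (is_normZ hq).
- rewrite uE => /(is_norm_eq0 hq) zx0.
  (* Applying the functional [a |-> <a z, z>] recovers [x] from [ketbra z z ⊗ x]. *)
  pose b (a : fop L) (x : E) := hdot L (a z) z *: x.
  have hb : is_bilinear b.
    split=> [w c a a'|a c w w'].
      by rewrite /b fopD fopZ linearPl /= scalerDl scalerA.
    by rewrite /b scalerDr !scalerA mulrC.
  have zz := dot_unit z1.
  have := tliftE (ketbra z z) x hb.
  rewrite zx0 (lin0 (tlift_linear hb)) /b ketbraE zz !scale1r zz scale1r => <-.
  by [].
Qed.

Lemma qnorm_pure_le (a : fop L) : exists2 K : R, 0 <= K &
  forall (E : qspace) (x : E), qnorm (a ⊗ x : ampl E) <= K * unorm x.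
Proof.
have [z [z1 uE]] := unormE; have [s ->] := fop_ketbra a.
exists (\sum_(p <- s) opnorm (ketbra p.1 z) * opnorm (ketbra z p.2)).
  by apply: sumr_ge0 => p _; rewrite mulr_ge0 ?opnorm_ge0.
move=> E x; rewrite (lin_sum ((pure_bilinear (fop L) E).1 x)).
rewrite (le_trans (is_norm_sum (qnorm_is_norm E) _ _))// mulr_suml ler_sum// => p _.
by rewrite (ketbra_factor _ _ z1) -biactE (le_trans (qnorm_biact _ _ _))// uE mulrAC.
Qed.

Lemma unorm_le_qnorm (w : L) : rnorm w = 1 -> exists2 K : R, 0 <= K &
  forall (E : qspace) (x : E), unorm x <= K * qnorm (ketbra w w ⊗ x : ampl E).
Proof.
move=> w1; have [z [z1 uE]] := unormE.
exists (opnorm (ketbra z w) * opnorm (ketbra w z)).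
  by rewrite mulr_ge0 ?opnorm_ge0.
move=> E x.
by rewrite uE (ketbra_factor _ _ w1) -biactE (le_trans (qnorm_biact _ _ _))// mulrAC.
Qed.

Lemma cb_unorm (E F : qspace) (phi : E -> F) M : linear phi ->
  (forall u : ampl E, qnorm (ampl_map phi u) <= M * qnorm u) ->
  forall x, unorm (phi x) <= M * unorm x.
Proof.
move=> lphi hM x; have [z [z1 uE]] := unormE.
by rewrite !uE -(ampl_mapE lphi).
Qed.

(** The amplification on rank one tensors involves [p ♦ p], which is again a rank
   one projection; the constant [K] compares it with [p]. *)
Lemma cc_unorm (Hs : hilbert_square L) (iota : unitary Hs L) (E F G : qspace)
    (B : E -> F -> G) : is_bilinear B -> completely_contractive iota B ->
  exists2 K : R, 0 <= K & forall x y, unorm (B x y) <= K * unorm x * unorm y.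
Proof.
move=> hB cB; have [z [z1 uE]] := unormE.
have w1 : rnorm (vdiamond iota z z) = 1.
  by rewrite (ts_norm (vdiamond_tensor_square iota)) z1 mulr1.
have [K K0 hK] := unorm_le_qnorm w1; exists K => // x y.
rewrite (le_trans (hK _ _))// -mulrA ler_wpM2l// !uE -fdiamond_ketbra.
by rewrite -(ampl_bilE iota hB) cB.
Qed.

(** Bounds on the amplification of a dense subspace extend to the whole space,
   because a tensor of [F ⊗ X] involves only finitely many vectors of [X]. *)
Lemma ampl_dense_bound (T : lmodType C) (X Z : qspace) (j : T -> X)
    (Phi : ampl X -> ampl Z) (M : R) : linear j -> linear Phi ->
  (forall (x : X) (eps : R), 0 < eps -> exists t, unorm (j t - x) < eps) ->
  (forall a : fop L, exists2 K : R, 0 <= K &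
     forall x : X, qnorm (Phi (a ⊗ x)) <= K * unorm x) ->
  (forall U : ampl T, qnorm (Phi (ampl_map j U)) <= M * qnorm (ampl_map j U : ampl X)) ->
  forall W, qnorm (Phi W) <= M * qnorm W.
Proof.
move=> lj lP dj bP bj W.
have hX := qnorm_is_norm X; have hZ := qnorm_is_norm Z.
have lampl := @ampl_map_linear R L _ _ _ lj.
suff h : forall e : R, 0 < e -> exists U : ampl T,
    qnorm (ampl_map j U - W) < e /\ qnorm (Phi (ampl_map j U) - Phi W) < e.
  apply: limit_bound hX hZ _ => e e0; have [U [h1 h2]] := h e e0.
  by exists (ampl_map j U), (Phi (ampl_map j U)); split.
elim/tens_ind: W => [a x|u v hu hv] e e0.
  have [K K0 hK] := bP a; have [K' K'0 hK'] := qnorm_pure_le a.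
  have [d d0 hd] := small_factor (K + K' + 1) e0.
  have [t ht] := dj x _ d0.
  have [pl pr] := pure_bilinear (fop L) X.
  exists (a ⊗ t); rewrite (ampl_mapE lj) -(linB lP) -(linB (pr a)).
  have hKd k : 0 <= k -> k <= K + K' -> k * unorm (j t - x) < e.
    move=> k0 hk; apply: lt_le_trans hd; rewrite mulrDl mul1r.
    apply: le_lt_trans (ler_wpM2l k0 (ltW ht)) _.
    by rewrite ltr_pwDr// ler_wpM2r// ltW.
  split; first by rewrite (le_lt_trans (hK' _ _))// hKd// lerDr.
  by rewrite (le_lt_trans (hK _))// hKd// lerDl.
have e20 : 0 < e / 2%:R by rewrite divr_gt0.
have [U [U1 U2]] := hu _ e20; have [V [V1 V2]] := hv _ e20.
exists (U + V); rewrite (linD lampl) !(linD lP) !opprD !(addrACA _ _ (- _)) [e]splitr.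
split.
  by rewrite (le_lt_trans (is_normD hX _ _))// ltrD.
by rewrite (le_lt_trans (is_normD hZ _ _))// ltrD.
Qed.

End QSpaceFacts.

(** * The operator-projective norm and its completion *)

Section OpNorm.
Variables (R : realType) (L : hilbert R).
Local Notation C := R[i].
Local Notation ampl := (ampl L).
Variables (Hs : hilbert_square L) (iota : unitary Hs L).
Hypothesis infL : infinite_dimensional L.
Local Notation vd := (vdiamond iota).

Section Representation.
Variables (V W : lmodType C).

Lemma diamond_tens_bilinear : is_bilinear (@diamond_tens R L Hs iota V W).
Proof. exact/ampl_bil_bilinear/pure_bilinear. Qed.

Lemma diamond_tensE a b (x : V) (y : W) :
  diamond_tens iota (a ⊗ x) (b ⊗ y) = fdiamond iota a b ⊗ (x ⊗ y).
Proof. exact/ampl_bilE/pure_bilinear. Qed.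

Lemma ampl_tens_rank_one (U : ampl (tens V W)) :
  exists s : seq ((L * L) * (V * W)),
    U = \sum_(p <- s) ketbra p.1.1 p.1.2 ⊗ (p.2.1 ⊗ p.2.2).
Proof.
have [pl pr] := pure_bilinear (fop L) (tens V W).
elim/tens_ind: U => [c t|u v [s ->] [t ->]]; last by exists (s ++ t); rewrite big_cat.
elim/tens_ind: t => [x y|u v [s hs] [t ht]].
  have [s ->] := fop_ketbra c; exists [seq (p, (x, y)) | p <- s].
  by rewrite big_map (lin_sum (pl _)).
by exists (s ++ t); rewrite big_cat (linD (pr c)) hs ht.
Qed.

(** To represent [∑ |ξ_i><η_i| ⊗ (x_i ⊗ y_i)], take orthonormal [f_i] and let [u], [v]
   have the coefficients [x_i], [y_i] on the projections on the [f_i]. Then [u ♦ v]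
   is a double sum, from which [a = ∑ |ξ_i><f_i ♦ f_i|] and [b = ∑ |f_i ♦ f_i><η_i|]
   select the diagonal terms. *)
Lemma op_representation (U : ampl (tens V W)) :
  exists (a b : fop L) u v, U = biact a (diamond_tens iota u v) b.
Proof.
have [s ->] := ampl_tens_rank_one U.
have [dl dr] := diamond_tens_bilinear.
have [pl pr] := pure_bilinear (fop L) (tens V W).
pose n := size s; have [f of_] := orthonormal_exists infL n.
pose d : (L * L) * (V * W) := ((0, 0), (0, 0)).
pose xi i := (nth d s i).1.1; pose eta i := (nth d s i).1.2.
pose x i := (nth d s i).2.1; pose y i := (nth d s i).2.2.
pose a : fop L := \sum_(i < n) ketbra (xi i) (vd (f i) (f i)).
pose b : fop L := \sum_(i < n) ketbra (vd (f i) (f i)) (eta i).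
pose u : ampl V := \sum_(i < n) ketbra (f i) (f i) ⊗ x i.
pose v : ampl W := \sum_(i < n) ketbra (f i) (f i) ⊗ y i.
have fE (i j k l : 'I_n) : hdot L (vd (f i) (f j)) (vd (f k) (f l)) =
    ((i == k) && (j == l))%:R.
  by rewrite (ts_dot (vdiamond_tensor_square iota)) !of_// -natrM mulnb.
have aE (i j : 'I_n) : a (vd (f i) (f j)) = (i == j)%:R *: xi i.
  rewrite fop_sum (bigD1 i) // big1 => [|k ki]; rewrite ketbraE fE.
    by rewrite eqxx /= addr0 eq_sym.
  by rewrite eq_sym (negbTE ki) scale0r.
have bE (i j : 'I_n) w : hdot L (b w) (vd (f i) (f j)) = (i == j)%:R * hdot L w (eta i).
  rewrite fop_sum linear_sumlz (bigD1 i) // big1 => [|k ki];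
    rewrite ketbraE linearZl_LR /= fE.
    by rewrite eqxx /= addr0 mulrC.
  by rewrite (negbTE ki) mulr0.
exists a, b, u, v; rewrite /u /v (lin_sum (dl _)) (lin_sum (biact_linear _ _)).
rewrite (big_nth d) big_mkord; apply: eq_bigr => i _.
rewrite (lin_sum (dr _)) (lin_sum (biact_linear _ _)).
have E (j : 'I_n) : biact a (diamond_tens iota (ketbra (f i) (f i) ⊗ x i)
    (ketbra (f j) (f j) ⊗ y j)) b =
    ((i == j)%:R *: ketbra (xi i) (eta i)) ⊗ (x i ⊗ y j).
  rewrite diamond_tensE biactE; congr (_ ⊗ _); apply: fop_ext => w.
  rewrite fopZ -[LHS]/(a (fdiamond iota (ketbra (f i) (f i)) (ketbra (f j) (f j)) (b w))).
  rewrite fdiamondE diamond_ketbra !ketbraE linearZ /= aE bE.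
  by case: (i == j); rewrite /= ?scale0r ?scaler0 ?scale1r ?mul1r.
rewrite (bigD1 i) // big1 => [|j ji]; rewrite E.
  by rewrite eqxx scale1r; symmetry; exact: addr0.
by rewrite eq_sym (negbTE ji) scale0r (lin0 (pl _)).
Qed.

End Representation.

Section Completion.
Variables (A E : qspace L) (X : op_completion iota A E).
Local Notation j := (@ampl_map R L _ _ (@oc_in _ _ _ _ _ _ X)).

Lemma op_norm_le (a b : fop L) (u : ampl A) (v : ampl E) :
  op_norm iota (biact a (diamond_tens iota u v) b) <=
  opnorm a * qnorm u * qnorm v * opnorm b.
Proof.
apply: ge_inf; last by exists a, b, u, v.
exists 0 => _ [a' [b' [u' [v' [_ ->]]]]].
by rewrite !mulr_ge0 ?opnorm_ge0 ?qnorm_ge0.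
Qed.

Lemma op_norm_approx (U : ampl (tens A E)) (eps : R) : 0 < eps ->
  exists (a b : fop L) (u : ampl A) (v : ampl E),
    U = biact a (diamond_tens iota u v) b /\
    opnorm a * qnorm u * qnorm v * opnorm b < op_norm iota U + eps.
Proof.
move=> e0; have [|_ [a [b [u [v [UE ->]]]]] h] := @inf_adherent _
  [set r | exists (a b : fop L) (u : ampl A) (v : ampl E),
    U = ract (lact a (diamond_tens iota u v)) b /\
    r = opnorm a * qnorm u * qnorm v * opnorm b] _ e0.
  split.
    have [a [b [u [v UE]]]] := op_representation U.
    by exists (opnorm a * qnorm u * qnorm v * opnorm b), a, b, u, v.
  exists 0 => _ [a' [b' [u' [v' [_ ->]]]]].
  by rewrite !mulr_ge0 ?opnorm_ge0 ?qnorm_ge0.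
by exists a, b, u, v.
Qed.

(** The completion being a Q-space on which the operator-projective norm is induced,
   that norm inherits the bimodule inequality, even for operators [a] and [b] of
   infinite rank. *)
Lemma qnorm_in_biact (a b : bop L) (U : ampl (tens A E)) :
  qnorm (j (biact a U b)) <= opnorm a * qnorm (j U) * opnorm b.
Proof. by rewrite (ampl_map_biact (oc_linear X)) qnorm_biact. Qed.

(** Supports provide a representation [P·(u ♦ v)·P] with [‖P‖ <= 1]. *)
Lemma qnorm_in_diamond (u : ampl A) (v : ampl E) :
  qnorm (j (diamond_tens iota u v)) <= qnorm u * qnorm v.
Proof.
have [P [P1 PE]] := biact_support (diamond_tens iota u v).
rewrite oc_isometric -PE (le_trans (op_norm_le _ _ _ _))//.
have h0 : 0 <= qnorm u * qnorm v by rewrite mulr_ge0 ?qnorm_ge0.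
apply: (le_trans (ler_piMr _ P1)); rewrite -mulrA ?ler_piMl//.
by rewrite mulr_ge0 ?opnorm_ge0.
Qed.

Lemma op_norm_bound (Z : qspace L) (Psi : ampl (tens A E) -> ampl Z) (M : R) : 0 <= M ->
  (forall (a b : fop L) u v,
    qnorm (Psi (biact a (diamond_tens iota u v) b)) <=
    M * (opnorm a * qnorm u * qnorm v * opnorm b)) ->
  forall U, qnorm (Psi U) <= M * qnorm (j U).
Proof.
move=> M0 hP U; rewrite oc_isometric; apply/ler_addgt0Pl => e e0.
have [d d0 hd] := small_factor M e0.
have [a [b [u [v [-> h]]]]] := op_norm_approx U d0.
rewrite (le_trans (hP _ _ _ _))// (le_trans (ler_wpM2l M0 (ltW h)))//.
by rewrite mulrDr addrC lerD2r.
Qed.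

(** The elements [a·(u ♦ v)·b] exhaust the amplification of the dense subspace, so a
   bound on them, taken to the infimum over representations, extends to the
   amplification of the completion. *)
Lemma completion_bound (Z : qspace L) (Phi : ampl X -> ampl Z) (M : R) : 0 <= M ->
  linear Phi ->
  (forall a : fop L, exists2 K : R, 0 <= K &
     forall x : X, qnorm (Phi (a ⊗ x)) <= K * unorm x) ->
  (forall (a b : fop L) u v,
    qnorm (Phi (j (biact a (diamond_tens iota u v) b))) <=
    M * (opnorm a * qnorm u * qnorm v * opnorm b)) ->
  forall W, qnorm (Phi W) <= M * qnorm W.
Proof.
move=> M0 lP bP hP; apply: (ampl_dense_bound infL (oc_linear X)) => //.
  exact: oc_dense.
exact: (op_norm_bound (Psi := fun U => Phi (j U))).
Qed.

Definition unorm_bounded (Z : qspace L) (S : X -> Z) : Prop :=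
  linear S /\ exists2 M : R, 0 <= M & forall x, unorm (S x) <= M * unorm x.

Lemma unorm_bounded_comb (Z : qspace L) c (S T : X -> Z) : unorm_bounded S -> unorm_bounded T ->
  unorm_bounded (fun x => c *: S x + T x).
Proof.
move=> [lS [M M0 bM]] [lT [N N0 bN]]; split.
  move=> k x y; rewrite lS lT !scalerDr !scalerA mulrC addrACA.
  by [].
have hZ := unorm_is_norm infL Z.
exists (cabs c * M + N); first by rewrite addr_ge0// mulr_ge0// cabs_ge0.
move=> x; rewrite (le_trans (is_normD hZ _ _))// (is_normZ hZ) mulrDl.
by rewrite lerD// -mulrA ler_wpM2l ?cabs_ge0.
Qed.

Lemma unorm_bounded_comp (Z Z' : qspace L) (T : Z -> Z') (S : X -> Z) M : linear T -> 0 <= M ->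
  (forall z, unorm (T z) <= M * unorm z) -> unorm_bounded S -> unorm_bounded (T \o S).
Proof.
move=> lT M0 bT [lS [N N0 bN]]; split; first by move=> k x y /=; rewrite lS lT.
exists (M * N); first by rewrite mulr_ge0.
by move=> x /=; rewrite (le_trans (bT _))// -mulrA ler_wpM2l.
Qed.

Lemma unorm_bounded_id : unorm_bounded (@id X).
Proof. by split=> //; exists 1 => // x; rewrite mul1r. Qed.

Lemma in_dense (x : X) (eps : R) : 0 < eps ->
  exists2 x' : X, range (oc_in X) x' & unorm (x' - x) < eps.
Proof. by move=> /(oc_dense x)[t ht]; exists (oc_in X t) => //; exists t. Qed.

Lemma completion_eq (Z : qspace L) (S T : X -> Z) : unorm_bounded S -> unorm_bounded T ->
  (forall a y, S (oc_pure X a y) = T (oc_pure X a y)) -> S =1 T.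
Proof.
move=> [lS [M _ bS]] [lT [N _ bT]] ST.
apply: (dense_eq (unorm_is_norm infL X) (unorm_is_norm infL Z) lS lT bS bT in_dense).
move=> _ [t _ <-]; elim/tens_ind: t => [a y|t t' h h']; first exact: ST.
by rewrite (linD (oc_linear X)) (linD lS) (linD lT) h h'.
Qed.

Lemma completion_extension (Z : banach_qspace L) (f : tens A E -> Z) M : linear f ->
  (forall t, unorm (f t) <= M * unorm (oc_in X t)) ->
  exists T : X -> Z, [/\ linear T, forall t, T (oc_in X t) = f t &
    forall x, unorm (T x) <= M * unorm x].
Proof.
move=> lf bf.
have lin := oc_linear X.
have [|||T [lT GT bT]] := @bounded_extension R X Z _ _
    (unorm_is_norm infL X) (unorm_is_norm infL Z) (@bq_complete _ _ Z)
    (fun x y => exists t, x = oc_in X t /\ y = f t) M.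
- by move=> c _ _ _ _ [t [-> ->]] [t' [-> ->]]; exists (c *: t + t'); rewrite lin lf.
- by move=> _ _ [t [-> ->]].
- by move=> x e /(oc_dense x)[t ht]; exists (oc_in X t), (f t); split=> //; exists t.
by exists T; split=> // t; apply: GT; exists t.
Qed.

End Completion.
End OpNorm.

(** * The module structure on the completion *)

Section Module.
Variables (R : realType) (L : hilbert R).
Local Notation C := R[i].
Local Notation ampl := (ampl L).
Variables (Hs : hilbert_square L) (iota : unitary Hs L).
Hypothesis infL : infinite_dimensional L.
Variables (A : qalgebra iota) (e : A) (E : banach_qspace L) (X : op_completion iota A E).
Local Notation j := (@ampl_map R L _ _ (@oc_in _ _ _ _ _ _ X)).
Let lin := oc_linear X.

Definition tens_act (a : A) (t : tens A E) : tens A E := tens_map (qmul a) id t.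

Lemma tens_actE a b y : tens_act a (b ⊗ y) = qmul a b ⊗ y.
Proof. exact: (tens_mapE ((qmul_bilinear A).2 a) (id_linear (E := E))). Qed.

Lemma tens_act_bilinear : is_bilinear tens_act.
Proof.
have lr a : linear (tens_act a).
  exact: (tens_map_linear ((qmul_bilinear A).2 a) (id_linear (E := E))).
have [pl pr] := pure_bilinear A E.
split=> // t c a b; elim/tens_ind: t => [a' y|t t' h h'].
  by rewrite !tens_actE (qmul_bilinear A).1 pl.
by rewrite !(linD (lr _)) h h' scalerDr addrACA.
Qed.

(** By multilinearity this is an identity between elementary tensors, where it
   combines [c ♦ (a T b) = (1 ♦ a)(c ♦ T)(1 ♦ b)] with the associativity of ♦ for
   [T = d ♦ f]. *)
Lemma tens_act_representation : exists V W : bop L, [/\ opnorm V <= 1, opnorm W <= 1 &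
  forall (w : ampl A) (a b : fop L) (u : ampl A) (v : ampl E),
    ampl_bil iota tens_act w (biact a (diamond_tens iota u v) b) =
    biact (bcomp (diamond iota (bid L) a) W)
      (diamond_tens iota (ampl_bil iota (@qmul _ _ _ _ A) w u) v)
      (bcomp V (diamond iota (bid L) b))].
Proof.
have [V [W [V1 W1 VW]]] := diamond_assoc iota.
exists V, W; split=> // w a b u v.
have [Bl Br] := ampl_bil_bilinear iota tens_act_bilinear.
have [Ml Mr] := ampl_bil_bilinear iota (qmul_bilinear A).
have [dl dr] := diamond_tens_bilinear iota A E.
have lb x y := @biact_linear R L (tens A E) x y.
elim/tens_ind: w => [c x|w w' h h']; last first.
  by rewrite (linD (Bl _)) (linD (Ml _)) (linD (dl _)) (linD (lb _ _)) h h'.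
elim/tens_ind: u => [d x'|u u' h h']; last first.
  by rewrite (linD (dl _)) (linD (lb _ _)) (linD (Br _)) (linD (Mr _)) (linD (dl _))
    (linD (lb _ _)) h h'.
elim/tens_ind: v => [f y|v v' h h']; last first.
  by rewrite !(linD (dr _)) !(linD (lb _ _)) (linD (Br _)) h h'.
rewrite (ampl_bilE iota (qmul_bilinear A)) !diamond_tensE !biactE.
rewrite (ampl_bilE iota tens_act_bilinear) tens_actE; congr (_ ⊗ _).
apply: val_inj; rewrite /= fdiamondE.
apply: bop_ext => z.
rewrite -[RHS]/(diamond iota (bid L) a ((bcomp W (bcomp (fdiamond iota (fdiamond iota c d) f) V))
  (diamond iota (bid L) b z))).
rewrite !fdiamondE VW -[RHS]/(bcomp (diamond iota (bid L) a)
  (bcomp (diamond iota c (diamond iota d f)) (diamond iota (bid L) b)) z).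
rewrite -!diamond_comp; congr (diamond _ _ _ z); apply: bop_ext => t //.
by rewrite /= fdiamondE.
Qed.

Lemma opnorm_diamond_bid (a : bop L) : opnorm (diamond iota (bid L) a) <= opnorm a.
Proof.
by rewrite (le_trans (opnorm_diamond _ _ _))// ler_piMl ?opnorm_ge0 ?opnorm_bid.
Qed.

Lemma tens_act_bound (w : ampl A) (U : ampl (tens A E)) :
  qnorm (j (ampl_bil iota tens_act w U)) <= qnorm w * qnorm (j U).
Proof.
have [V [W [V1 W1 VW]]] := tens_act_representation.
have q0 := @qnorm_ge0 R L.
apply: (op_norm_bound infL X (Psi := fun U => j (ampl_bil iota tens_act w U))) => //.
move=> a b u v; rewrite VW (le_trans (qnorm_in_biact _ _ _ _))//.
have ha : opnorm (bcomp (diamond iota (bid L) a) W) <= opnorm a.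
  rewrite (le_trans (opnorm_bcomp _ _))//.
  by rewrite (le_trans (ler_piMr _ W1)) ?opnorm_ge0// opnorm_diamond_bid.
have hb : opnorm (bcomp V (diamond iota (bid L) b)) <= opnorm b.
  rewrite (le_trans (opnorm_bcomp _ _))//.
  by rewrite (le_trans (ler_piMl _ V1)) ?opnorm_ge0// opnorm_diamond_bid.
have hu : qnorm (j (diamond_tens iota (ampl_bil iota (@qmul _ _ _ _ A) w u) v))
    <= qnorm w * qnorm u * qnorm v.
  by rewrite (le_trans (qnorm_in_diamond _ _ _))// ler_wpM2r// qmul_cc.
have -> : qnorm w * (opnorm a * qnorm u * qnorm v * opnorm b) =
    opnorm a * (qnorm w * qnorm u * qnorm v) * opnorm b by ring.
by rewrite ler_pM ?mulr_ge0 ?opnorm_ge0// ler_pM ?opnorm_ge0.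
Qed.

(** Rank one tensors turn the amplified bound into one on underlying norms, up to the
   constant which compares [p ♦ p] with [p]. *)
Lemma tens_act_unorm : exists2 K : R, 0 <= K & forall a t,
  unorm (oc_in X (tens_act a t)) <= K * unorm a * unorm (oc_in X t).
Proof.
have [z [z1 uE]] := unormE infL.
have w1 : rnorm (vdiamond iota z z) = 1.
  by rewrite (ts_norm (vdiamond_tensor_square iota)) z1 mulr1.
have [K K0 hK] := unorm_le_qnorm infL w1; exists K => // a t.
rewrite (le_trans (hK _ _))// -mulrA ler_wpM2l// !uE.
rewrite -!(ampl_mapE lin) -fdiamond_ketbra -(ampl_bilE iota tens_act_bilinear).
exact: tens_act_bound.
Qed.

Definition extends_tens_act (m : A -> X -> X) :=
  forall a b y, m a (oc_pure X b y) = oc_pure X (qmul a b) y.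

Lemma qmodule_unorm_bounded (Y : qspace L) (m : A -> Y -> Y) (S : X -> Y) a :
  is_qmodule e m -> unorm_bounded S -> unorm_bounded (fun x => m a (S x)).
Proof.
move=> hm hS; have [K K0 hK] := cc_unorm infL (act_bilinear hm) (act_cc hm).
apply: (unorm_bounded_comp (T := m a) (M := K * unorm a)) => //.
- exact: (act_bilinear hm).2.
- by rewrite mulr_ge0// (is_norm_ge0 (unorm_is_norm infL A)).
Qed.

Lemma completion_act_unique (m m' : A -> X -> X) :
  is_qmodule e m -> is_qmodule e m' ->
  extends_tens_act m -> extends_tens_act m' -> m = m'.
Proof.
move=> hm hm' pm pm'; apply/funext => a; apply/funext; apply: (completion_eq infL).
- exact: qmodule_unorm_bounded hm (unorm_bounded_id X).
- exact: qmodule_unorm_bounded hm' (unorm_bounded_id X).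
- by move=> b y; rewrite pm pm'.
Qed.

(** Each [a] acts by the continuous extension of [tens_act a]; the module axioms hold
   on elementary tensors, and complete contractivity on the dense subspace is
   [tens_act_bound]. *)
Lemma completion_act_exists : is_identity e ->
  exists m : A -> X -> X, is_qmodule e m /\ extends_tens_act m.
Proof.
move=> [e_l e_r].
have [tl tr] := tens_act_bilinear.
have [K K0 hK] := tens_act_unorm.
have uA0 (a : A) : 0 <= unorm a by exact: (is_norm_ge0 (unorm_is_norm infL A)).
have /choice [m hm] : forall a, exists T : X -> X, [/\ linear T,
    forall t, T (oc_in X t) = oc_in X (tens_act a t) &
    forall x, unorm (T x) <= K * unorm a * unorm x].
  move=> a; apply: (completion_extension infL (f := fun t => oc_in X (tens_act a t))).
    by move=> c t t'; rewrite tr lin.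
  by move=> t; exact: hK.
have um a : unorm_bounded (m a).
  by have [lm _ bm] := hm a; split=> //; exists (K * unorm a) => //; rewrite mulr_ge0.
have pm : extends_tens_act m.
  by move=> a b y; have [_ mE _] := hm a; rewrite /oc_pure mE tens_actE.
have bm : is_bilinear m.
  split=> [x c a b|a]; last by case: (um a).
  apply: (completion_eq infL (S := m (c *: a + b)) (T := fun x => c *: m a x + m b x)) => //.
    exact: unorm_bounded_comb.
  move=> a' y; rewrite !pm /oc_pure -lin; congr oc_in.
  by rewrite (qmul_bilinear A).1 (pure_bilinear A E).1.
have umm S a : unorm_bounded S -> unorm_bounded (fun x => m a (S x)).
  have [lm _ bma] := hm a.
  by apply: (unorm_bounded_comp lm _ bma); rewrite mulr_ge0.
exists m; split=> //; split=> //.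
- move=> a b; apply: (completion_eq infL (S := m (qmul a b))) => //.
    exact: umm.
  by move=> a' y; rewrite !pm qmulA.
- apply: (completion_eq infL (T := id)) => //; first exact: unorm_bounded_id.
  by move=> a y; rewrite pm e_l.
move=> w; have [ml mr] := ampl_bil_bilinear iota bm.
apply: (completion_bound infL (Phi := ampl_bil iota m w)) => //; first exact: qnorm_ge0.
- move=> b; elim/tens_ind: w => [a x|w w' [M M0 hM] [N N0 hN]].
    have [M M0 hM] := qnorm_pure_le infL (fdiamond iota a b).
    exists (M * (K * unorm x)); first by rewrite !mulr_ge0.
    move=> x'; rewrite (ampl_bilE iota bm) (le_trans (hM _ _))//.
    by rewrite -mulrA ler_wpM2l//; have [_ _] := hm x; exact.
  exists (M + N); first exact: addr_ge0.
  move=> x; rewrite (linD (ml _)) (le_trans (is_normD (qnorm_is_norm X) _ _))//.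
  by rewrite mulrDl lerD.
- move=> a b u v; set U := biact _ _ _.
  have -> : ampl_bil iota m w (j U) = j (ampl_bil iota tens_act w U).
    have [Bl Br] := ampl_bil_bilinear iota tens_act_bilinear.
    have lj := @ampl_map_linear R L _ _ _ lin.
    elim/tens_ind: U => [c t|U V h h']; last first.
      by rewrite (linD lj) (linD (mr _)) h h' (linD (Br _)) (linD lj).
    elim/tens_ind: w => [d x|w w' h h']; last first.
      by rewrite (linD (ml _)) h h' (linD (Bl _)) (linD lj).
    rewrite (ampl_mapE lin) (ampl_bilE iota bm) (ampl_bilE iota tens_act_bilinear).
    by rewrite (ampl_mapE lin); have [_ -> _] := hm x.
  rewrite (le_trans (tens_act_bound _ _))// ler_wpM2l ?qnorm_ge0//.
  by rewrite oc_isometric op_norm_le.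
Qed.

End Module.

(** * The adjunction *)

Section Free.
Variables (R : realType) (L : hilbert R).
Local Notation C := R[i].
Local Notation ampl := (ampl L).
Variables (Hs : hilbert_square L) (iota : unitary Hs L).
Hypothesis infL : infinite_dimensional L.
Variables (A : qalgebra iota) (e : A) (e_identity : is_identity e).
Variables (E : banach_qspace L) (X : op_completion iota A E).
Variables (m : A -> X -> X) (m_module : is_qmodule e m) (m_ext : extends_tens_act m).
Local Notation j := (@ampl_map R L _ _ (@oc_in _ _ _ _ _ _ X)).
Local Notation AE := (BanachQmodule m_module).
Let lin := oc_linear X.

Lemma cb_nonneg_bound (Y Z : qspace L) (phi : cb_map Y Z) :
  exists2 M : R, 0 <= M & forall u : ampl Y, qnorm (ampl_map phi u) <= M * qnorm u.
Proof.
have [M hM] := cb_bounded phi; exists (Num.max M 0); first by rewrite le_max lexx orbT.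
by move=> u; rewrite (le_trans (hM u))// ler_wpM2r ?qnorm_ge0// le_max lexx.
Qed.

Lemma cb_unorm_bounded (Z : qspace L) (S : cb_map X Z) : unorm_bounded S.
Proof.
have [M M0 hM] := cb_nonneg_bound S; split; first exact: cb_linear.
by exists M => //; apply: (cb_unorm infL (cb_linear S) hM).
Qed.

Section Extension.
Variables (Y : banach_qmodule e) (phi : cb_map E Y).

Let b (a : A) (x : E) : Y := qact a (phi x).

Let b_bilinear : is_bilinear b.
Proof.
have [ql qr] := act_bilinear (qactP Y).
by split=> [x c a a'|a c x x']; rewrite /b ?ql// cb_linear qr.
Qed.

Let lf := tlift_linear b_bilinear.

Let f_diamond (u : ampl A) (v : ampl E) :
  ampl_map (tlift b) (diamond_tens iota u v) =
  ampl_bil iota (@qact _ _ _ _ _ _ Y) u (ampl_map phi v).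
Proof.
have [Bl Br] := ampl_bil_bilinear iota (act_bilinear (qactP Y)).
have [dl dr] := diamond_tens_bilinear iota A E.
have lF := @ampl_map_linear R L _ _ _ lf.
have lphi := @ampl_map_linear R L _ _ _ (cb_linear phi).
elim/tens_ind: u => [c x|u u' h h']; last by rewrite (linD (dl _)) (linD lF) (linD (Bl _)) h h'.
elim/tens_ind: v => [d y|v v' h h'].
  rewrite diamond_tensE (ampl_mapE lf) (ampl_mapE (cb_linear phi)).
  by rewrite (ampl_bilE iota (act_bilinear (qactP Y))) tliftE.
by rewrite (linD (dr _)) !(linD lF) (linD lphi) (linD (Br _)) h h'.
Qed.

(** The contractivity of the outer multiplication of [Y] bounds the amplification of
   [a ⊗ x |-> a·φ(x)] on each representation [a·(u ♦ v)·b]. *)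
Lemma free_extension : exists S : qmod_hom AE Y,
  forall a x, S (oc_pure X a x) = qact a (phi x).
Proof.
have [M M0 hM] := cb_nonneg_bound phi.
have fM (U : ampl (tens A E)) : qnorm (ampl_map (tlift b) U) <= M * qnorm (j U).
  apply: (op_norm_bound infL X) => // a a' u v.
  rewrite (ampl_map_biact lf) f_diamond (le_trans (qnorm_biact _ _ _))//.
  have h := act_cc (qactP Y) u (ampl_map phi v).
  have -> : M * (opnorm a * qnorm u * qnorm v * opnorm a') =
      opnorm a * (qnorm u * (M * qnorm v)) * opnorm a' by ring.
  rewrite ler_wpM2r ?opnorm_ge0// ler_wpM2l ?opnorm_ge0// (le_trans h)//.
  by rewrite ler_wpM2l ?qnorm_ge0.
have [z [z1 uE]] := unormE infL.
have [t|T [lT TE bT]] := completion_extension infL (X := X) (M := M) lf.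
  by rewrite !uE -(ampl_mapE lf) -(ampl_mapE lin).
have lTa := @ampl_map_linear R L _ _ _ lT.
have cbT : completely_bounded T.
  exists M; apply: (completion_bound infL (Phi := ampl_map T)) => //.
    move=> a; have [K K0 hK] := qnorm_pure_le infL a.
    exists (K * M) => [|x]; first by rewrite mulr_ge0.
    by rewrite (ampl_mapE lT) (le_trans (hK _ _))// -mulrA ler_wpM2l.
  move=> a a' u v; set U := biact _ _ _.
  have -> : ampl_map T (j U) = ampl_map (tlift b) U.
    by rewrite -(ampl_map_comp lT lin); congr (ampl_map _ U); apply/funext => t /=.
  by rewrite (le_trans (fM _))// ler_wpM2l// oc_isometric op_norm_le.
have Tpure a x : T (oc_pure X a x) = qact a (phi x) by rewrite TE tliftE.
have uT : unorm_bounded T by split=> //; exists M.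
have Tact a x : CbMap lT cbT (m a x) = qact a (CbMap lT cbT x).
  apply: (completion_eq infL (S := fun x => T (m a x)) (T := fun x => qact a (T x))).
  - apply: (unorm_bounded_comp (T := T) (S := m a) lT M0 bT).
    exact: (qmodule_unorm_bounded infL a m_module (unorm_bounded_id X)).
  - exact: (qmodule_unorm_bounded infL a (qactP Y) uT).
  - by move=> a' y; rewrite m_ext !Tpure (actA (qactP Y)).
by exists (@QmodHom _ _ _ _ _ _ AE Y (CbMap lT cbT) Tact).
Qed.

Lemma free_extension_unique (S T : qmod_hom AE Y) :
  (forall a x, S (oc_pure X a x) = T (oc_pure X a x)) -> S = T.
Proof.
move=> ST; apply: qmod_hom_ext; apply: (completion_eq infL) => //.
  exact: (cb_unorm_bounded (S : cb_map X Y)).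
exact: (cb_unorm_bounded (T : cb_map X Y)).
Qed.

End Extension.

(** The unit of the adjunction. Its amplification at [v] is the corner, in the sense
   of [diamond_corner], of [(p ⊗ e) ♦ v], whose norm is at most [‖p ⊗ e‖ ‖v‖]. *)
Lemma free_unit : exists eta : cb_map E X, forall x, eta x = oc_pure X e x.
Proof.
have [pl pr] := pure_bilinear A E.
have le_ : linear (oc_pure X e) by move=> c x y; rewrite /oc_pure pr lin.
have [z [z1 uE]] := unormE infL.
have [S [T hST]] := diamond_corner iota z1.
have cb : completely_bounded (oc_pure X e).
  exists (opnorm T * qnorm (ketbra z z ⊗ e : ampl A) * opnorm S) => v.
  have -> : ampl_map (oc_pure X e) v =
      j (biact T (diamond_tens iota (ketbra z z ⊗ e) v) S).
    have [dl dr] := diamond_tens_bilinear iota A E.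
    have lj := @ampl_map_linear R L _ _ _ lin.
    elim/tens_ind: v => [c x|v v' h h'].
      rewrite (ampl_mapE le_) diamond_tensE biactE (ampl_mapE lin).
      congr (_ ⊗ _); apply: fop_ext => t; rewrite -[LHS](congr1 (fun a : bop L => a t) (hST c)).
      by rewrite /= fdiamondE.
    rewrite (linD (@ampl_map_linear R L _ _ _ le_)) h h'.
    by rewrite (linD (dr _)) (linD (@biact_linear R L _ _ _)) (linD lj).
  rewrite (le_trans (qnorm_in_biact _ _ _ _))// [leRHS]mulrAC.
  rewrite ler_wpM2r ?opnorm_ge0// -mulrA ler_wpM2l ?opnorm_ge0//.
  exact: qnorm_in_diamond.
by exists (CbMap le_ cb).
Qed.

Lemma free_object : exists I : @free_structure (QAmod_rigged e) E AE,
  forall (Y : banach_qmodule e) (phi : cb_map E Y) (S : qmod_hom AE Y),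
    S = I Y phi <-> (forall a x, S (oc_pure X a x) = qact a (phi x)).
Proof.
have [e_l e_r] := e_identity; have [eta etaE] := free_unit.
pose I (Y : banach_qmodule e) (phi : cb_map E Y) : qmod_hom AE Y :=
  sval (cid (free_extension phi)).
have IE Y phi a x : I Y phi (oc_pure X a x) = qact a (phi x).
  exact: (svalP (cid (free_extension phi))).
have I_bij Y : bijective (I Y).
  exists (fun S : qmod_hom AE Y => cb_comp (S : cb_map X Y) eta) => [phi|S].
    by apply: cb_map_ext => x; rewrite /= etaE IE (act1 (qactP Y)).
  apply: free_extension_unique => a x.
  by rewrite IE /= etaE -(qh_act S) /= m_ext e_r.
have I_nat (Y Z : banach_qmodule e) (g : qmod_hom Y Z) (phi : cb_map E Y) :
    I Z (cb_comp (g : cb_map Y Z) phi) = qh_comp g (I Y phi).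
  by apply: free_extension_unique => a x; rewrite IE /= IE qh_act.
exists (@FreeStructure (QAmod_rigged e) E AE I I_bij I_nat) => Y phi S.
split=> [->|SE]; first exact: IE.
by apply: free_extension_unique => a x; rewrite SE IE.
Qed.

End Free.

Local Close Scope classical_set_scope.

Theorem proposition5 (R : realType) (L : hilbert R)
    (L_separable : separable L) (L_infinite : infinite_dimensional L)
    (H : hilbert_square L) (iota : unitary H L)
    (A : qalgebra iota) (A_complete : qcomplete A)
    (e : A) (e_identity : is_identity e) (e_norm : unorm e = 1)
    (E : banach_qspace L) (X : op_completion iota A E) :
  (exists! m : A -> X -> X,
      is_qmodule e m /\
      (forall a b y, m a (oc_pure X b y) = oc_pure X (qmul a b) y))
  /\
  (forall (m : A -> X -> X) (m_module : is_qmodule e m)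
      (m_pure : forall a b y, m a (oc_pure X b y) = oc_pure X (qmul a b) y),
    let AE : banach_qmodule e := BanachQmodule m_module in
    exists I : @free_structure (QAmod_rigged e) E AE,
      forall (Y : banach_qmodule e) (phi : cb_map E Y) (S : qmod_hom AE Y),
        S = I Y phi <->
        (forall a x, S (oc_pure X a x) = qact a (phi x))).
Proof.
split; last by move=> m m_module m_pure; exact: free_object.
have [m [hm pm]] := completion_act_exists L_infinite X e_identity.
exists m; split=> // m' [hm' pm'].
exact: (completion_act_unique L_infinite hm hm' pm pm').
Qed.
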